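(* Every nice graph $G=(V,E)$ is total weight $(1,5)$-choosable: for every assignment $L$ that assigns to each vertex $v\in V$ a set $L(v)$ of exactly $1$ real number and to each edge $e\in E$ a set $L(e)$ of exactly $5$ real numbers, there is a map $\phi:V\cup E\to\mathbb{R}$ with $\phi(z)\in L(z)$ for all $z\in V\cup E$ such that for every edge $\{u,v\}\in E$, $$\sum_{e\in E(u)}\phi(e)+\phi(u)\neq\sum_{e\in E(v)}\phi(e)+\phi(v).$$
   Context: All graphs are finite and simple; an edge is a $2$-element subset $\{i,j\}$ of the vertex set. For a vertex $i$, $E(i)$ denotes the set of edges incident to $i$. An edge $\{i,j\}$ is isolated if both $i$ and $j$ have degree $1$. A graph is nice if it has no isolated edges. *)

(* Defs.v *)
From mathcomp Require Import all_boot all_order all_algebra.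
From mathcomp Require Import reals.
Set Implicit Arguments. Unset Strict Implicit. Unset Printing Implicit Defensive.

(* A finite simple graph on vertex set T is given by its edge set
   E : {set {set T}}, every edge being a 2-element subset of T. *)
Definition simple_graph (T : finType) (E : {set {set T}}) : Prop :=
  forall e, e \in E -> #|e| = 2.

Definition incident (T : finType) (E : {set {set T}}) (i : T) : {set {set T}} :=
  [set e in E | i \in e].

Definition degree (T : finType) (E : {set {set T}}) (i : T) : nat :=
  #|incident E i|.

Definition isolated_edge (T : finType) (E : {set {set T}}) (e : {set T}) : Prop :=
  e \in E /\ forall i, i \in e -> degree E i = 1.

Definition nice (T : finType) (E : {set {set T}}) : Prop :=
  forall e, ~ isolated_edge E e.

(* Main.v *)
Require Import Defs.
From mathcomp Require Import all_boot all_order all_fingroup all_algebra.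
From mathcomp Require Import ring.
From mathcomp Require Import reals.
Set Implicit Arguments. Unset Strict Implicit. Unset Printing Implicit Defensive.
Import Order.TTheory GRing.Theory Num.Theory.

(** Write X_v for the sum of the variables of the edges at v. By the
    Combinatorial Nullstellensatz it suffices that the product P of the
    X_v - X_u over the edges, possibly multiplied by further linear forms, has
    a nonzero coefficient at a monomial of degree at most 4 in every edge
    variable. Such a coefficient appears in the expansion of the permanent of
    the pairings <row, column>, where the rows are the linear forms above and
    the columns are vectors in the span of the y_uv = x_u + x_v (uv an edge),
    each y_uv being used by at most 4 columns.

    Let S be an independent set maximizing 2|S| plus its number of pendant
    vertices, W its complement, and order the vertices with W before S. If
    v and v' are consecutive later neighbours of u, then y_uv - y_uv' is
    x_v - x_v'. For v in W these columns match the rows of the edges inside W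
    triangularly. For v in S each column x_v - x_v' is taken twice; the
    freedom to multiply P by forms X_s then makes the permanent of the S-block
    the coefficient of a monomial in a product of squares (x_s +- x_s')^2,
    equal up to sign to a sum of squares.

    This serves every edge between W and S, except at the set U of those u in W
    with a single neighbour t u in S. There one uses columns x_(t a) + x_(t b)
    or x_(t a) - x_(t b) obtained from walks t a - a - b - t b or
    t a - a - x - b - t b; these walks are found by pairing the vertices of U
    bottom-up along a rooted spanning forest of G[W]. When the pairing leaves
    an element of U over in a component, one vertex of that component, placed
    last in W, belongs to two walks. *)

(** * A permanent form of the Combinatorial Nullstellensatz *)

Section PermanentNullstellensatz.
Local Open Scope ring_scope.

Definition fiber (I : finType) (Y : eqType) (g : I -> Y) (y : Y) : nat :=
  #|[pred i | g i == y]|.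

Lemma same_fiber_perm (I : finType) (Y : eqType) (f g : I -> Y) :
  (forall y, fiber f y = fiber g y) -> exists s : {perm I}, forall i, f (s i) = g i.
Proof.
move=> fib.
have : perm_eq (codom g) (codom_tuple f).
  rewrite /perm_eq; apply/allP => y _ /=; rewrite !count_map.
  have := fib y; rewrite /fiber !cardE !size_filter -!enumT => h.
  by apply/eqP; rewrite -[LHS]h.
case/tuple_permP => p def_g.
have inj_s : injective (fun i => enum_val (p (enum_rank i))).
  by move=> i j /enum_val_inj /perm_inj /enum_rank_inj.
exists (perm inj_s) => i; rewrite permE.
have := congr1 (fun s => nth (g i) s (enum_rank i)) def_g.
rewrite nth_codom enum_rankK => ->.
rewrite -[nth _ _ _]/(nth _ (map _ _) _) (nth_map (enum_rank i)) ?size_enum_ord //.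
by rewrite nth_ord_enum (tnth_nth (g i)) nth_codom.
Qed.

Lemma sum_fiber (I Y : finType) (g : I -> Y) : (\sum_y fiber g y = #|I|)%N.
Proof.
rewrite -sum1_card (partition_big g xpredT) //=; apply: eq_bigr => y _.
by rewrite sum1_card.
Qed.

Lemma prod_fiber (F : comPzRingType) (I Y : finType) (g : I -> Y) (v : Y -> F) :
  \prod_i v (g i) = \prod_y v y ^+ fiber g y.
Proof.
rewrite (partition_big g xpredT) //=; apply: eq_bigr => y _.
by rewrite (eq_bigr (fun=> v y)) => [|i /eqP-> //]; rewrite prodr_const.
Qed.

(** The weights are a column of the inverse Vandermonde matrix on the nodes [s]: a functional
    reading off the degree-[k] coefficient of a polynomial of degree below [size s] from its
    values. *)
Lemma moment_functional (F : fieldType) (s : seq F) (k : nat) :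
  uniq s -> (k < size s)%N ->
  exists w : 'I_(size s) -> F,
    forall m, (m < size s)%N -> \sum_j w j * s`_j ^+ m = (m == k)%:R.
Proof.
move=> us lt_k; pose a : 'rV[F]_(size s) := \row_j s`_j.
have uV : Vandermonde (size s) a \in unitmx.
  rewrite unitmxE unitfE det_Vandermonde; apply/prodf_neq0 => i _.
  apply/prodf_neq0 => j lt_ij; rewrite !mxE subr_eq0 nth_uniq //.
  by rewrite neq_ltn lt_ij orbT.
pose v := invmx (Vandermonde (size s) a) *m delta_mx (Ordinal lt_k) (0 : 'I_1).
exists (fun j => v j 0) => m lt_m.
have : (Vandermonde (size s) a *m v) (Ordinal lt_m) 0 = (m == k)%:R.
  by rewrite mulKVmx // mxE eqxx andbT.
by move=> <-; rewrite mxE; apply: eq_bigr => j _; rewrite !mxE mulrC.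
Qed.

Section Nullstellensatz.
Variables (F : fieldType) (I Y : finType) (y0 : Y) (d : nat).
Variables (A c : I -> Y -> F) (L : Y -> seq F).
Hypothesis uL : forall y, uniq (L y).
Hypothesis sL : forall y, size (L y) = d.+1.

(** The coordinate [y0] is frozen to 1, so that it carries the constant terms of affine forms. *)
Let pt (f : {ffun Y -> 'I_d.+1}) y := if y == y0 then 1 else (L y)`_(f y).

(** Applying a moment functional in each variable other than [y0] to a product vanishing on the grid
    isolates the coefficient at [K]. A different monomial has the same total degree, so its exponent
    is below that of [K] in some such variable, whose functional kills it; moments of degree above
    [d] thus never matter. *)
Lemma grid_coef_eq0 (K : Y -> nat) :
  (forall f, \prod_i \sum_y A i y * pt f y = 0) ->
  (forall y, K y <= d)%N -> K y0 = 0%N -> (\sum_y K y = #|I|)%N ->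
  \sum_(g : {ffun I -> Y} | [forall y, fiber g y == K y]) \prod_i A i (g i) = 0.
Proof.
move=> vanish leK K0 sumK.
have /fin_all_exists[w wP] y : exists w : 'I_d.+1 -> F,
    forall m, (m <= d)%N || (y == y0) ->
      \sum_j w j * (if y == y0 then 1 else (L y)`_j) ^+ m
        = ((m == K y) || (y == y0))%:R.
  have [_ | ny0] := eqVneq y y0.
    (* At [y0] a point mass has every moment equal to 1. *)
    exists (fun j => (j == ord0)%:R) => m _.
    rewrite (bigD1 ord0) //= big1 => [|j /negPf->]; last by rewrite mul0r.
    by rewrite expr1n !mulr1 addr0 orbT.
  have ltk : (K y < size (L y))%N by rewrite sL ltnS.
  have [w wP] := moment_functional (uL y) ltk.
  exists (fun j => w (cast_ord (esym (sL y)) j)) => m; rewrite orbF => le_m.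
  rewrite orbF -wP ?sL // (reindex (cast_ord (esym (sL y)))) //.
  by exists (cast_ord (sL y)) => j _; rewrite ?cast_ordK ?cast_ordKV.
have : \sum_(f : {ffun Y -> 'I_d.+1})
    (\prod_y w y (f y)) * \prod_i \sum_y A i y * pt f y = 0.
  by apply: big1 => f _; rewrite vanish mulr0.
under eq_bigr => f _ do rewrite bigA_distr_bigA big_distrr /=.
rewrite exchange_big /= => sum0; rewrite -[RHS]sum0 big_mkcond /=.
apply: eq_bigr => g _.
under [RHS]eq_bigr => f _ do
  rewrite big_split /= (prod_fiber g (pt f)) mulrCA -big_split /=.
rewrite -big_distrr /=.
rewrite -(bigA_distr_bigA (fun y j =>
  w y j * (if y == y0 then 1 else (L y)`_j) ^+ fiber g y)) /=.
case: ifP => [/forallP fibK | /negbT nfib].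
  rewrite [X in _ * X]big1 ?mulr1 // => y _.
  by rewrite wP (eqP (fibK y)) ?leK // eqxx.
have [/existsP[y /andP[ny0 lt_y]] | nlt] :=
    boolP [exists y, (y != y0) && (fiber g y < K y)%N].
  rewrite (bigD1 y) //= wP ?(negPf ny0); last by rewrite orbF (leq_trans (ltnW lt_y)).
  by rewrite (ltn_eqF lt_y) /= mul0r mulr0.
case/negP: nfib; apply/forallP.
have leKf y : (K y <= fiber g y)%N.
  have [-> | ny0] := eqVneq y y0; first by rewrite K0.
  by rewrite leqNgt; apply: contra nlt => lty; apply/existsP; exists y; rewrite ny0.
have /leqif_sum : forall y, xpredT y -> (K y <= fiber g y ?= iff (K y == fiber g y))%N.
  by move=> y _; split.
by rewrite sumK sum_fiber => -[_ /esym]; rewrite eqxx => /forallP h y;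
rewrite eq_sym; exact: h.
Qed.

Hypothesis c0 : forall i, c i y0 = 0.
Hypothesis usage : forall y, (#|[set i | (c i y != 0)%R]| <= d)%N.

(* The permanent of the pairings is a linear combination of coefficients of
   prod_i (sum_y A i y * x_y) at monomials of degree at most d in each x_y. *)
Lemma grid_nonzero_of_permanent :
  \sum_(s : {perm I}) \prod_i \sum_y A i y * c (s i) y != 0 ->
  exists phi : Y -> F, [/\ phi y0 = 1, forall y, y != y0 -> phi y \in L y
    & forall i, \sum_y A i y * phi y != 0].
Proof.
move=> per_neq0.
have [/existsP[f nz] | /existsPn vanish] :=
    boolP [exists f, \prod_i \sum_y A i y * pt f y != 0].
  exists (pt f); split=> [|y ny|i]; rewrite /pt ?eqxx //.
    by rewrite (negPf ny) mem_nth // sL.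
  by move: nz; rewrite (bigD1 i) //= mulf_eq0 negb_or => /andP[].
(* [H g] is the coefficient of the permanent at the choice [g] of one variable per row; it vanishes
   unless [g] respects the usage bounds and avoids [y0]. *)
pose H (g : {ffun I -> Y}) := \sum_(s : {perm I}) \prod_i c (s i) (g i).
have H_small g y : H g != 0 -> (fiber g y <= d)%N && (fiber g y0 == 0%N).
  move=> Hg; have [s _ nz] : exists2 s : {perm I}, true & \prod_i c (s i) (g i) != 0.
    apply/exists_inP; apply: contraR Hg => /exists_inPn h.
    by rewrite /H big1 // => s _; apply/eqP; rewrite -[_ == _]negbK h.
  have nzi i : c (s i) (g i) != 0.
    by move: nz; rewrite (bigD1 i) //= mulf_eq0 negb_or => /andP[].
  apply/andP; split; last first.
    rewrite /fiber -leqn0 leqNgt; apply/negP => /card_gt0P[i /eqP gi].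
    by move: (nzi i); rewrite gi c0 eqxx.
  apply: leq_trans (usage y).
  rewrite /fiber -(card_imset [pred i | g i == y] (@perm_inj _ s)).
  apply/subset_leq_card/subsetP => j /imsetP[i].
  by rewrite !inE => /eqP <- ->.
have H_perm (g g' : {ffun I -> Y}) : (forall y, fiber g y = fiber g' y) -> H g = H g'.
  case/same_fiber_perm => p gp; rewrite /H (reindex_inj (mulgI p^-1%g)) /=.
  apply: eq_bigr => s _; rewrite (reindex_inj (@perm_inj _ p)) /=.
  by apply: eq_bigr => i _; rewrite gp permM permK.
case/eqP: per_neq0.
transitivity (\sum_(g : {ffun I -> Y}) (\prod_i A i (g i)) * H g).
  under eq_bigr => s _ do rewrite bigA_distr_bigA.
  rewrite exchange_big /=; apply: eq_bigr => g _.
  by rewrite big_distrr; apply: eq_bigr => s _; rewrite big_split.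
(* [inord] confuses fibres larger than [d], but such [g] have [H g = 0]. *)
pose key (g : {ffun I -> Y}) := [ffun y => inord (fiber g y) : 'I_d.+1].
rewrite (partition_big key xpredT) //=; apply: big1 => K _.
have [/exists_inP[g0 /eqP key0 nz0] | /exists_inPn h] :=
    boolP [exists (g | key g == K), H g != 0]; last first.
  apply: big1 => g keyg; have /negPn/eqP Hg0 := h g keyg.
  by rewrite Hg0 mulr0.
have fibK (g : {ffun I -> Y}) y : key g = K -> H g != 0 -> fiber g y = K y.
  by move=> <- /(H_small _ y)/andP[le_d _]; rewrite ffunE inordK ?ltnS.
transitivity (\sum_(g : {ffun I -> Y} | [forall y, fiber g y == fiber g0 y])
    (\prod_i A i (g i)) * H g0).
  rewrite big_mkcond [RHS]big_mkcond; apply: eq_bigr => g _.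
  case: ifP => [/eqP keyg | nkey]; case: ifP => [/forallP fg | nf] //.
  - by rewrite (H_perm g g0) // => y; apply/eqP.
  - have [-> | Hg] := eqVneq (H g) 0; first by rewrite mulr0.
    by case/negP: nf; apply/forallP => y; rewrite (fibK g) // (fibK g0).
  case/eqP: nkey; rewrite -key0; apply/ffunP => y; rewrite !ffunE.
  by rewrite (eqP (fg y)).
rewrite -big_distrl /= grid_coef_eq0 ?mul0r //.
- by move=> f; apply/eqP; move: (vanish f); rewrite negbK.
- by move=> y; case/andP: (H_small g0 y nz0).
- by have /andP[_ /eqP] := H_small g0 y0 nz0.
- exact: sum_fiber.
Qed.

End Nullstellensatz.

End PermanentNullstellensatz.

(** * Permanents *)

Section Permanents.
Local Open Scope ring_scope.

Definition permanent (F : pzRingType) (I : finType) (M : I -> I -> F) : F :=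
  \sum_(s : {perm I}) \prod_i M i (s i).

Section SumPerm.
Variables A B : finType.

Definition sum_fun (p : {perm A} * {perm B}) (i : A + B) : A + B :=
  match i with inl a => inl (p.1 a) | inr b => inr (p.2 b) end.

Lemma sum_fun_inj p : injective (sum_fun p).
Proof. by case=> [a|b] [a'|b'] //= [] /perm_inj->. Qed.

Definition sum_perm p : {perm A + B} := perm (@sum_fun_inj p).

Lemma sum_perm_inj : injective sum_perm.
Proof.
move=> [p q] [p' q'] /permP eqp; congr (_, _); apply/permP => x.
  by have := eqp (inl x); rewrite !permE => -[].
by have := eqp (inr x); rewrite !permE => -[].
Qed.

(** Injectivity and finiteness make [s] onto on the left summand, so it cannot send the right one
    there. *)
Lemma sum_perm_surj (s : {perm A + B}) :
  (forall a b, s (inl a) != inr b) -> exists p, s = sum_perm p.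
Proof.
move=> sA.
have sAE a : {a' | s (inl a) = inl a'}.
  by case E: (s (inl a)) => [a'|b]; [exists a' | case/eqP: (sA a b)].
pose f a := sval (sAE a).
have fE a : s (inl a) = inl (f a) by rewrite /f; case: (sAE a).
have f_inj : injective f.
  by move=> a a' eqf; have := fE a; rewrite eqf -fE => /perm_inj [].
have sBE b : {b' | s (inr b) = inr b'}.
  case E: (s (inr b)) => [a|b']; last by exists b'.
  have := fE (invF f_inj a); rewrite f_invF -E => /perm_inj //.
pose g b := sval (sBE b).
have gE b : s (inr b) = inr (g b) by rewrite /g; case: (sBE b).
have g_inj : injective g.
  by move=> b b' eqg; have := gE b; rewrite eqg -gE => /perm_inj [].
exists (perm f_inj, perm g_inj); apply/permP => -[a|b]; rewrite permE /= permE.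
  exact: fE.
exact: gE.
Qed.

(** Only permutations respecting the two summands contribute: any other one sends some left row to a
    right column and meets a zero entry. *)
Lemma permanent_block (F : comPzRingType) (M : A + B -> A + B -> F) :
  (forall a b, M (inl a) (inr b) = 0) ->
  permanent M = permanent (fun a a' => M (inl a) (inl a'))
              * permanent (fun b b' => M (inr b) (inr b')).
Proof.
move=> M0; rewrite /permanent (bigID (mem [set sum_perm p | p in setT])) /=.
rewrite [X in _ + X]big1 ?addr0 => [|s nim].
  rewrite big_imset => [|p q _ _ /sum_perm_inj //].
  rewrite big_distrlr pair_big /=; apply: eq_big => [p|p _]; first by rewrite inE.
  rewrite big_sumType /=; congr (_ * _);
    by apply: eq_bigr => x _; rewrite permE.
have /existsP[a /existsP[b /eqP E]] : [exists a, exists b, s (inl a) == inr b].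
  apply: contraR nim => /existsPn h; have [|p ->] := @sum_perm_surj s.
    by move=> a b; have /existsPn := h a; apply.
  exact: imset_f.
by rewrite (bigD1 (inl a)) //= E M0 mul0r.
Qed.

End SumPerm.

(** Along a nonzero term ranks never increase, while a permutation preserves their sum; so all ranks
    are kept and the term is 1. The permanent thus counts rank-preserving permutations, among them
    the identity. *)
Lemma permanent_ranked (F : numDomainType) (I : finType) (M : I -> I -> F)
    (r : I -> nat) :
  (forall i j, M i j != 0 -> (r j <= r i)%N) ->
  (forall i j, r j = r i -> M i j = 1) -> permanent M != 0.
Proof.
move=> Mle M1.
have -> : permanent M = #|[set s : {perm I} | [forall i, r (s i) == r i]]|%:R.
  rewrite /permanent -sum1_card natr_sum [RHS]big_mkcond /=; apply: eq_bigr => s _.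
  rewrite inE; case: ifP => [/forallP rs | nrs].
    by apply: big1 => i _; apply/M1/eqP/rs.
  apply/eqP; apply: contraFT nrs => nz.
  have le_r i : (r (s i) <= r i)%N.
    by apply: Mle; move: nz; rewrite (bigD1 i) //= mulf_eq0 negb_or => /andP[].
  have /leqif_sum : forall i, xpredT i -> (r (s i) <= r i ?= iff (r (s i) == r i))%N.
    by move=> i _; split.
  have -> : (\sum_i r (s i) = \sum_i r i)%N by rewrite [RHS](reindex_perm s).
  by case=> _ /esym; rewrite eqxx.
rewrite pnatr_eq0 -lt0n; apply/card_gt0P; exists 1%g.
by rewrite inE; apply/forallP => i; rewrite perm1.
Qed.

Lemma big_prod_bool (R : Type) (idx : R) (op : Monoid.com_law idx) (K : finType)
    (G : K * bool -> R) :
  \big[op/idx]_j G j = \big[op/idx]_l op (G (l, true)) (G (l, false)).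
Proof.
transitivity (\big[op/idx]_l \big[op/idx]_b G (l, b)).
  by rewrite pair_bigA; apply: eq_bigr => -[].
by apply: eq_bigr => l _; rewrite big_bool.
Qed.

Lemma fiberE (I : finType) (Y : eqType) (g : I -> Y) y :
  fiber g y = (\sum_i (g i == y))%N.
Proof.
by rewrite /fiber -sum1_card big_mkcond; apply: eq_bigr => i _; rewrite inE; case: eqP.
Qed.

(** * Doubled links: a permanent as a sum of squares *)

Section LinkPermanent.
Variables (F : realFieldType) (K V : finType) (lab : K -> bool -> V) (eps : K -> F).
Hypothesis eps2 : forall l, eps l * eps l = 1.
Hypothesis eps1 : forall l, lab l false = lab l true -> eps l = 1.

Implicit Types o : {ffun K -> bool}.

Let labB (j : K * bool) := lab j.1 j.2.
(** An orientation [o] selects a term in the expansion of prod_l (x_(lab l false) + eps l * x_(lab l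
    true)): [sg o] is its sign and [cnt o] gives its exponents. Equal [key] means equal monomial. *)
Let sg o := \prod_l (if o l then eps l else 1).
Let neg o : {ffun K -> bool} := [ffun l => ~~ o l].
Let cnt o (v : V) := fiber (fun l => lab l (o l)) v.
Let key o : {ffun V -> 'I_#|K|.+1} := [ffun v => inord (cnt o v)].

Lemma neg_involutive : involutive neg.
Proof. by move=> o; apply/ffunP => l; rewrite !ffunE negbK. Qed.

Lemma key_eq o o' : (key o == key o') = [forall v, cnt o v == cnt o' v].
Proof.
apply/eqP/forallP => [eqk v | eqc].
  have ltc o1 : (cnt o1 v < #|K|.+1)%N by rewrite ltnS max_card.
  have /ffunP/(_ v) := eqk; rewrite !ffunE => /(congr1 val) /=.
  by rewrite !inordK // => ->.
by apply/ffunP => v; rewrite !ffunE (eqP (eqc v)).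
Qed.

Lemma sg_neg o : sg (neg o) = (\prod_l eps l) * sg o.
Proof.
rewrite /sg -big_split /=; apply: eq_bigr => l _; rewrite ffunE.
by case: (o l); rewrite /= ?eps2 ?mulr1.
Qed.

Lemma cnt_neg o v : (cnt o v + cnt (neg o) v = fiber labB v)%N.
Proof.
rewrite /cnt !fiberE big_prod_bool -big_split; apply: eq_bigr => l _ /=.
by rewrite ffunE /labB; case: (o l); rewrite // addnC.
Qed.

(** Otherwise every coefficient of that product would vanish; but at distinct positive values of the
    variables each factor is a nonzero sum or difference. *)
Lemma sum_sg_key_neq0 : exists k, \sum_(o | key o == k) sg o != 0.
Proof.
apply/existsP; apply: contraT => /existsPn h.
pose z (v : V) : F := (enum_rank v).+1%:R.
have z_gt0 v : 0 < z v by rewrite ltr0n.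
have : \prod_l \sum_(b : bool) (if b then eps l else 1) * z (lab l b) != 0.
  apply/prodf_neq0 => l _; rewrite big_bool /= mul1r.
  have [eq_l | ne_l] := eqVneq (lab l false) (lab l true).
    by rewrite eps1 // mul1r gt_eqF // addr_gt0.
  have: (eps l == 1) || (eps l == -1) by rewrite -sqrf_eq1 expr2 eps2.
  case/orP => /eqP->; first by rewrite mul1r gt_eqF // addr_gt0.
  rewrite mulN1r addrC subr_eq0 eqr_nat eqSS.
  by apply: contraNneq ne_l => /val_inj/enum_rank_inj->.
rewrite bigA_distr_bigA /=.
rewrite (partition_big key xpredT) //= big1 ?eqxx // => k _.
have [/existsP[o0 /eqP key0] | /existsPn no] := boolP [exists o, key o == k]; last first.
  by rewrite big1 // => o; rewrite (negPf (no o)).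
rewrite (eq_bigr (fun o => sg o * \prod_v z v ^+ cnt o0 v)).
  by rewrite -big_distrl /= (eqP (negPn (h k))) mul0r.
move=> o /eqP keyo; rewrite big_split /=; congr (_ * _).
rewrite (prod_fiber (fun l => lab l (o l))); apply: eq_bigr => v _.
have : key o == key o0 by rewrite keyo key0.
by rewrite key_eq => /forallP/(_ v)/eqP; rewrite /cnt => ->.
Qed.

Let pair_fun (p : {ffun K -> bool} * {ffun K -> bool}) : {ffun K * bool -> bool} :=
  [ffun j => if j.2 then p.2 j.1 else neg p.1 j.1].

Lemma pair_fun_bij : bijective pair_fun.
Proof.
exists (fun q : {ffun K * bool -> bool} =>
  (neg [ffun l => q (l, false)], [ffun l => q (l, true)])).
  by case=> o o'; congr (_, _); apply/ffunP => l; rewrite ?ffunE //= ?ffunE /= ?ffunE ?negbK.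
by move=> q; apply/ffunP => -[l b]; rewrite !ffunE /=; case: b; rewrite /= ?ffunE ?negbK.
Qed.

(* Each link occurs twice as a column. Reversing the orientation chosen in one
   copy turns the permanent into a multiple of a sum of squares of the
   coefficients of prod_l (x_(lab l false) + eps l * x_(lab l true)). *)
Lemma link_permanent_neq0 :
  permanent (fun i j : K * bool => (labB i == lab j.1 false)%:R
               + eps j.1 * (labB i == lab j.1 true)%:R) != 0.
Proof.
pose s (j : K * bool) (b : bool) : F := if b then eps j.1 else 1.
pose N (q : {ffun K * bool -> bool}) : nat :=
  #|[set p : {perm K * bool} | [forall j, labB (p j) == lab j.1 (q j)]]|.
pose N0 := #|[set p : {perm K * bool} | [forall j, labB (p j) == labB j]]|.
have N0_gt0 : (0 < N0)%N.
  by apply/card_gt0P; exists 1%g; rewrite inE; apply/forallP => j; rewrite perm1.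
have -> : permanent (fun i j : K * bool => (labB i == lab j.1 false)%:R
               + eps j.1 * (labB i == lab j.1 true)%:R)
          = \sum_(q : {ffun K * bool -> bool}) (\prod_j s j (q j)) * (N q)%:R.
  transitivity (\sum_(p : {perm K * bool}) \sum_(q : {ffun K * bool -> bool})
      (\prod_j s j (q j)) * [forall j, labB (p j) == lab j.1 (q j)]%:R).
    rewrite /permanent (reindex_inj invg_inj) /=; apply: eq_bigr => p _.
    rewrite (reindex_inj (@perm_inj _ p)) /=.
    transitivity (\prod_j \sum_(b : bool) s j b * (labB (p j) == lab j.1 b)%:R).
      by apply: eq_bigr => j _; rewrite permK big_bool /s /= mul1r addrC.
    rewrite bigA_distr_bigA; apply: eq_bigr => q _; rewrite big_split /=.
    congr (_ * _); case: (boolP [forall _, _]) => [/forallP h | /forallPn[j nj]].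
      by apply: big1 => j _; rewrite h.
    by rewrite (bigD1 j) //= (negPf nj) mul0r.
  rewrite exchange_big /=; apply: eq_bigr => q _; rewrite -big_distrr /=.
  congr (_ * _); rewrite /N -sum1_card natr_sum [RHS]big_mkcond /=.
  by apply: eq_bigr => p _; rewrite inE; case: ifP.
(* The permutations counted by [N q] form a coset of the group of label-preserving ones, counted by
   [N0], or there are none. *)
have NE q : N q = (if [forall v, fiber labB v == fiber (fun j => lab j.1 (q j)) v]
                   then N0 else 0)%N.
  case: ifP => [/forallP fib | nfib]; last first.
    apply: eq_card0 => p; rewrite inE; apply: contraFF nfib => /forallP h.
    apply/forallP => v; apply/eqP; rewrite /fiber -!sum1_card (reindex_perm p) /=.
    by apply: eq_bigl => j; rewrite !inE (eqP (h j)).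
  have [p0 h0] := @same_fiber_perm _ _ labB (fun j => lab j.1 (q j))
                    (fun v => eqP (fib v)).
  rewrite /N /N0 -(card_imset _ (mulgI p0^-1%g)); apply: eq_card => p.
  rewrite -[p](mulKg p0) mem_imset; last exact: mulgI.
  rewrite !inE mulKg; apply/forallP/forallP => h j.
    by have := h (p0^-1%g j); rewrite permM permKV -h0 permKV.
  by have := h (p0 j); rewrite permM -h0.
rewrite (reindex pair_fun) /=; last by apply/onW_bij/pair_fun_bij.
have fibE o o' v : (fiber labB v == fiber (fun j => lab j.1 (pair_fun (o, o') j)) v)
                   = (cnt o v == cnt o' v).
  have -> : fiber (fun j => lab j.1 (pair_fun (o, o') j)) v
            = (cnt (neg o) v + cnt o' v)%N.
    rewrite /cnt !fiberE big_prod_bool -big_split; apply: eq_bigr => l _ /=.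
    by rewrite !ffunE /= addnC.
  by rewrite -(cnt_neg o) addnC eqn_add2l.
(* The matching condition is now that [o] and [o'] give the same monomial, and the reversal
   contributes the factor prod_l eps l; grouping by monomial leaves squares. *)
have -> : \sum_p (\prod_j s j (pair_fun p j)) * (N (pair_fun p))%:R
   = (\prod_l eps l) * N0%:R * \sum_k (\sum_(o | key o == k) sg o) ^+ 2.
  transitivity (\sum_o \sum_o' (\prod_l eps l) * N0%:R
       * (if key o == key o' then sg o * sg o' else 0)).
    rewrite pair_big /=; apply: eq_bigr => -[o o'] _ /=; rewrite NE.
    under eq_forallb => v do rewrite fibE.
    rewrite -key_eq; case: ifP => _; last by rewrite !mulr0.
    rewrite [LHS]mulrC -!mulrA [RHS]mulrCA; congr (_ * _).
    rewrite mulrA -sg_neg /sg -big_split /=.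
    rewrite big_prod_bool; apply: eq_bigr => l _ /=.
    by rewrite !ffunE mulrC.
  transitivity ((\prod_l eps l) * N0%:R
      * \sum_o \sum_o' (if key o == key o' then sg o * sg o' else 0)).
    by rewrite mulr_sumr; apply: eq_bigr => o _; rewrite mulr_sumr.
  congr (_ * _).
  rewrite (partition_big key xpredT) //=; apply: eq_bigr => k _.
  rewrite expr2 big_distrl /=; apply: eq_bigr => o /eqP keyo.
  by rewrite -big_mkcond big_distrr /= keyo; apply: eq_bigl => o'; rewrite eq_sym.
rewrite !mulf_neq0 ?pnatr_eq0 -?lt0n //.
  apply/prodf_neq0 => l _; apply/eqP => eps0; move/eqP: (eps2 l).
  by rewrite eps0 mul0r eq_sym oner_eq0.
have [k nz] := sum_sg_key_neq0; rewrite gt_eqF // (bigD1 k) //=.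
rewrite ltr_pwDl ?exprn_even_gt0 ?sumr_ge0 // => *; exact: sqr_ge0.
Qed.

End LinkPermanent.

End Permanents.

(** * Pairing the vertices with one neighbour in S *)

(** A breadth-first forest of the components of W: [h] is the distance to the root [r] and [p] the
    next vertex on a shortest path. Taking the root outside U whenever possible forces a component
    whose root is in U to lie inside U. *)
Lemma rooted_forest (T : finType) (adj : rel T) (W U : {set T}) :
  symmetric adj ->
  exists (r p : T -> T) (h : T -> nat),
    [/\ forall x y, x \in W -> y \in W -> adj x y -> r x = r y,
        forall x, x \in W -> r x \in U -> x \in U
      & forall x, x \in W -> x != r x ->
          [/\ p x \in W, adj x (p x), (h (p x) < h x)%N & adj x (r x) -> p x = r x]].
Proof.
move=> sym_adj; pose e := [rel x y | [&& adj x y, x \in W & y \in W]].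
have sym_e : connect_sym e.
  by apply: sym_connect_sym => x y; rewrite /= sym_adj [(x \in W) && _]andbC.
have closedW : closed e (mem W) by move=> x y /and3P[_ -> ->].
pose r x := odflt (fingraph.root e x) [pick y | (y \in W :\: U) && connect e x y].
have r_connect x y : connect e x y -> r x = r y.
  move=> cxy; rewrite /r.
  rewrite (@eq_pick _ _ [pred z | (z \in W :\: U) && connect e y z]).
    by congr odflt; apply/eqP; rewrite root_connect.
  by move=> z /=; rewrite (same_connect sym_e cxy).
have connect_r x : connect e x (r x).
  by rewrite /r; case: pickP => [y /andP[] //|_]; apply: connect_root.
have rW x : x \in W -> r x \in W.
  by move=> Wx; rewrite -(closed_connect closedW (connect_r x)).
have r_adj x y : x \in W -> y \in W -> adj x y -> r x = r y.
  by move=> Wx Wy axy; apply/r_connect/connect1; rewrite /= axy Wx.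
pose reach x n := [exists t : n.-tuple T, path e x t && (last x t == r x)].
have reachP x q : path e x q -> last x q = r x -> reach x (size q).
  by move=> pq lq; apply/existsP; exists (in_tuple q); rewrite pq lq eqxx.
have /fin_all_exists[h hP] x : exists n, reach x n /\ forall m, reach x m -> n <= m.
  have /connectP[q pq lq] := connect_r x.
  have ex : exists n, reach x n by exists (size q); apply: reachP.
  by case: (ex_minnP ex) => n; exists n.
have /fin_all_exists[p pP] x : exists y, x \in W -> x != r x ->
    [/\ y \in W, adj x y, h y < h x & adj x (r x) -> y = r x].
  have [/existsP[t /andP[pt /eqP lt]] min_h] := hP x.
  case Dt: (tval t) pt lt => [|y q] /=.
    by move=> _ xr; exists x => _; rewrite -xr eqxx.
  case/andP=> /and3P[axy Wx Wy] pq lq; exists y => _ _.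
  have hx : h x = (size q).+1 by have := size_tuple t; rewrite Dt.
  have ry : r y = r x by rewrite -(r_adj x y).
  split=> //.
    by rewrite hx ltnS; have [_] := hP y; apply; apply: reachP; rewrite ?ry.
  move=> axr; have : h x <= 1.
    apply: min_h; apply: (reachP x [:: r x]) => //=.
    by rewrite axr Wx rW.
  by rewrite hx ltnS leqn0 size_eq0 => /eqP q0; rewrite -lq q0.
exists r, p, h; split=> //.
move=> x Wx; apply: contraTT => nUx; rewrite /r.
case: pickP => [y /andP[/setDP[]] // | /(_ x)].
by rewrite /= inE nUx Wx connect0.
Qed.

(* A link (a, x, b) stands for the walk t a - a - b - t b if x = b,
   and for t a - a - x - b - t b otherwise. *)
Definition link_deg (T : finType) (La : {set T * T * T}) (v : T) : nat :=
  \sum_(l in La) ((l.1.1 == v) + (l.2 == v)).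

Definition link_uses (T : finType) (l : T * T * T) (e : {set T}) : bool :=
  (e == [set l.1.1; l.1.2]) || (l.1.2 != l.2) && (e == [set l.1.2; l.2]).

Section LinkDeg.
Variable T : finType.
Implicit Types (La : {set T * T * T}) (l : T * T * T) (v : T).

Definition is_end l v := (l.1.1 == v) || (l.2 == v).

Lemma link_degU1 La l v : l \notin La ->
  link_deg (l |: La) v = ((l.1.1 == v) + (l.2 == v) + link_deg La v)%N.
Proof. by move=> nl; rewrite /link_deg big_setU1. Qed.

Lemma link_degU La La' v : [disjoint La & La'] ->
  link_deg (La :|: La') v = (link_deg La v + link_deg La' v)%N.
Proof.
move=> dLa; rewrite {1}/link_deg (big_setID La) /= setUK setDUl setDv set0U.
by congr (_ + _)%N; rewrite (setDidPl _) // disjoint_sym.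
Qed.

Lemma link_degD1 La l v : l \in La ->
  link_deg La v = ((l.1.1 == v) + (l.2 == v) + link_deg (La :\ l) v)%N.
Proof. by move=> Ll; rewrite /link_deg (big_setD1 l). Qed.

Lemma link_deg_gt0 La v :
  (0 < link_deg La v)%N -> exists2 l, l \in La & is_end l v.
Proof.
move=> dv; apply/exists_inP; apply: contraTT dv => /exists_inPn h.
rewrite -leqNgt leqn0 sum_nat_eq0; apply/forall_inP => l /h.
by rewrite negb_or => /andP[/negPf-> /negPf->].
Qed.

Lemma is_end_link_deg La l v : l \in La -> is_end l v -> (0 < link_deg La v)%N.
Proof.
by move=> Ll; rewrite /is_end (link_degD1 _ Ll); do 2![case: eqP => // _].
Qed.

Lemma link_deg_le1_inj La l l' v : (link_deg La v <= 1)%N ->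
  l \in La -> l' \in La -> is_end l v -> is_end l' v -> l = l'.
Proof.
move=> d1 Ll Ll' el el'; apply/eqP; apply: contraTT d1 => nll'.
have L'l' : l' \in La :\ l by rewrite !inE eq_sym nll'.
have d2 := is_end_link_deg L'l' el'.
rewrite -ltnNge (link_degD1 _ Ll) -addn1 leq_add //.
by move: el; rewrite /is_end; do 2![case: eqP => // _].
Qed.

End LinkDeg.

Section Links.
Variables (T : finType) (adj : rel T) (W U : {set T}) (t : T -> T).
Hypothesis sym_adj : symmetric adj.
Hypothesis irr_adj : irreflexive adj.
Hypothesis subUW : U \subset W.
Hypothesis U_nbr : forall u, u \in U -> exists2 w, w \in W & adj u w.
Hypothesis U_adj : forall u v, u \in U -> v \in U -> u != v -> t u = t v -> adj u v.

Variables (r p : T -> T) (h : T -> nat).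
Hypothesis r_adj : forall x y, x \in W -> y \in W -> adj x y -> r x = r y.
Hypothesis rU : forall x, x \in W -> r x \in U -> x \in U.
Hypothesis pP : forall x, x \in W -> x != r x ->
  [/\ p x \in W, adj x (p x), h (p x) < h x & adj x (r x) -> p x = r x].

Implicit Types (La : {set T * T * T}) (s : seq T).

(** [UpLink] joins a vertex to its parent. [CherryLink] joins two children through their parent when
    their [t] differ; when the [t] agree, the children are adjacent and [SiblingLink] uses the edge
    between them. *)
Variant link_kind s (a x b : T) : Prop :=
| UpLink of x = b & b = p a
| CherryLink of x = p a & b \in s & b \in U & p b = p a & a != b & t a != t b
| SiblingLink of x = b & b \in s & b \in U & p b = p a & adj a b.

(* Here s lists the vertices treated so far, children before parents; a vertex
   outside s can only be the upper end of an UpLink. Roots in U keep one or two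
   links once they have received one. *)
Definition good_links La s : Prop :=
  [/\ forall a x b, (a, x, b) \in La -> [/\ a \in s, a \in U & link_kind s a x b],
      forall v, link_deg La v <= 1 + ((v == r v) && (v \in U)),
      forall v, v \in s -> v \in U -> 0 < link_deg La v
    & forall a x b, (a, x, b) \in La -> x == r x -> x \in U -> 0 < link_deg La x].

Lemma link_kind_cons s a x b y : link_kind s a x b -> link_kind (y :: s) a x b.
Proof.
case=> *; [exact: UpLink | apply: CherryLink => // | apply: SiblingLink => //];
  by rewrite inE; apply/orP; right.
Qed.

(** The tail of [s] is treated first, so the parent of [x] is still untreated. If [x] needs a link,
    it is linked to its parent when that has room. Otherwise the parent is the upper end of a link
    from a sibling [a], and this link is replaced by one joining [a] and [x], leaving the parent
    with one link fewer. *)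
Lemma good_links_exist s :
  sorted (relpre h leq) s -> uniq s -> {in s, forall x, (x \in W) && (x != r x)} ->
  exists La, good_links La s.
Proof.
elim: s => [|x s IHs] /=.
  move=> _ _ _; exists set0; split=> [a x b|v|//|a x b]; rewrite ?inE //.
  by rewrite /link_deg big_set0.
move=> path_s /andP[nsx us] Ws.
have [|La [kind dle dgt0 droot]] := IHs (path_sorted path_s) us.
  by move=> y sy; apply: Ws; rewrite inE sy orbT.
have /andP[Wx nrx] := Ws x (mem_head _ _).
have [Wpx axpx lt_h _] := pP Wx nrx.
have npx : p x \notin s.
  apply/negP => /(allP (order_path_min _ path_s)).
  by rewrite /= leqNgt lt_h => /(_ (fun _ _ _ => @leq_trans _ _ _)).
have kind' a y b : (a, y, b) \in La -> [/\ a \in x :: s, a \in U & link_kind (x :: s) a y b].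
  case/kind=> sa Ua ka; split=> //; first by rewrite inE sa orbT.
  exact: link_kind_cons.
have [skip | ] := boolP ((x \notin U) || (0 < link_deg La x)).
  exists La; split=> // v; rewrite inE => /orP[/eqP-> Ux|]; last exact: dgt0.
  by move: skip; rewrite Ux.
rewrite negb_or negbK -leqNgt leqn0 => /andP[Ux /eqP dx0].
have npxx : (p x == x) = false by apply: contraTF axpx => /eqP->; rewrite irr_adj.
have [dz | dz] := ltnP (link_deg La (p x)) (1 + ((p x == r (p x)) && (p x \in U))).
  pose l := (x, p x, p x).
  have nLl : l \notin La.
    by apply/negP => Ll; have := @is_end_link_deg _ _ _ x Ll; rewrite /is_end eqxx dx0 => /(_ isT).
  have degE v : link_deg (l |: La) v = ((x == v) + (p x == v) + link_deg La v)%N.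
    exact: link_degU1.
  exists (l |: La); split.
  - move=> a y b; rewrite inE => /orP[|]; last exact: kind'.
    by rewrite inE => /eqP[-> -> ->]; split; rewrite ?mem_head //; apply: UpLink.
  - move=> v; rewrite degE; have := dle v.
    have [<-|_] := eqVneq x v; first by rewrite dx0 npxx.
    by have [<-|//] := eqVneq (p x) v; rewrite add0n.
  - move=> v; rewrite degE inE => /orP[/eqP-> _|sv Uv]; first by rewrite eqxx.
    by rewrite ltn_addl // dgt0.
  - move=> a y b; rewrite inE => /orP[|Ll ry Uy]; rewrite degE.
      by rewrite inE => /eqP[_ -> _]; rewrite eqxx addn1.
    by rewrite ltn_addl // (droot a y b).
have [[[a y] b] Ll] : exists2 l, l \in La & is_end l (p x).
  by apply: link_deg_gt0; apply: leq_trans dz.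
have [sa Ua ka] := kind _ _ _ Ll.
have nax : a != x by apply: contraNneq nsx => <-.
have napx : a != p x by apply: contraNneq npx => <-.
rewrite /is_end /= (negPf napx) /= => /eqP bpx.
case: ka => [yb bpa | | ]; try by move=> *; case/negP: npx; rewrite -bpx.
move: Ll bpa; rewrite {y}yb {b}bpx => Ll bpa.
(* If [t a = t x], going through the parent would give the zero vector x_(t a) - x_(t x); the edge
   from [a] to [x], supplied by [U_adj], is used instead. *)
pose m := if t a == t x then x else p x; pose l := (a, m, x).
have nLl : l \notin La :\ (a, p x, p x).
  apply/negP => /setD1P[_] Lm; have := @is_end_link_deg _ _ _ x Lm.
  by rewrite /is_end eqxx orbT dx0 => /(_ isT).
have degE v : (link_deg (l |: (La :\ (a, p x, p x))) v + (p x == v) =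
               link_deg La v + (x == v))%N.
  rewrite link_degU1 // (link_degD1 _ Ll) /= -!addnA; congr (_ + _)%N.
  by rewrite addnA addnC [((x == v) + _)%N]addnC.
exists (l |: (La :\ (a, p x, p x))); split.
- move=> a' y b; rewrite inE => /orP[|/setD1P[_]]; last exact: kind'.
  rewrite inE => /eqP[-> -> ->]; split; rewrite ?inE ?sa ?orbT //.
  rewrite /m; case: (eqVneq (t a) (t x)) => [eqt | net].
    by apply: SiblingLink; rewrite ?mem_head //; apply: U_adj.
  by apply: CherryLink; rewrite ?mem_head.
- move=> v; have := degE v; have := dle v.
  have [<-|_] := eqVneq x v; first by rewrite dx0 npxx addn0 => _ ->; apply: leq_addr.
  by rewrite addn0 => le_v eqd; apply: leq_trans le_v; rewrite -eqd leq_addr.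
- move=> v; rewrite inE => /orP[/eqP-> _|sv Uv].
    by have := degE x; rewrite eqxx npxx dx0 addn0 => ->.
  have npv : p x != v by apply: contraNneq npx => ->.
  by have := degE v; rewrite (negPf npv) addn0 => ->; rewrite ltn_addr // dgt0.
(* A full root in U has two links and loses one, so it stays covered. *)
- move=> a' y b La' ry Uy; have := degE y; have [pxy | npxy] := eqVneq (p x) y.
    move: dz; rewrite pxy ry Uy => dz eqd.
    by rewrite -ltnS -(addn1 (link_deg _ _)) eqd; apply: leq_trans dz (leq_addr _ _).
  rewrite addn0 => ->; apply: ltn_addr.
  move: La'; rewrite inE => /orP[|/setD1P[_ La']]; last exact: droot La' _ _.
  rewrite inE => /eqP[_ ym _]; move: npxy ry; rewrite ym /m.
  by case: (t a == t x); rewrite ?eqxx ?(negPf nrx).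
Qed.

(** Only roots in U can lack a link; these form [Bad]. Each [z] in [Bad] gets a link from a child
    [c z], which is in U because the whole component is, and which may then carry two links. So a
    component has at most one vertex of [D], whence independence. *)
Lemma links_of_forest :
  exists (La : {set T * T * T}) (D : {set T}),
  [/\ forall a x b, (a, x, b) \in La ->
        [/\ a \in W, x \in W, b \in W, adj a x
          & x = b \/ [/\ adj x b, a != b & t a != t b]],
      forall e l l', l \in La -> l' \in La -> link_uses l e -> link_uses l' e -> l = l',
      forall v, link_deg La v <= 1 + (v \in D),
      forall u, u \in U -> 0 < link_deg La u
    & D \subset U /\ forall x y, x \in D -> y \in D -> ~~ adj x y].
Proof.
pose s := sort (relpre h leq) (enum [set x in W | x != r x]).
have mem_s x : (x \in s) = (x \in W) && (x != r x) by rewrite mem_sort mem_enum inE.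
have [||x|La [kind dle dgt0 droot]] := @good_links_exist s.
- by apply: sort_sorted => x y; apply: leq_total.
- by rewrite sort_uniq enum_uniq.
- by rewrite mem_s.
have WU x : x \in U -> x \in W by apply: (subsetP subUW).
pose Bad := [set z in U | (z == r z) && (link_deg La z == 0)].
have /fin_all_exists[c cP] z : exists c, z \in Bad ->
    [/\ c \in W, c != r c, p c = z & r c = z].
  have [Bz|] := boolP (z \in Bad); last by exists z.
  move: Bz; rewrite !inE => /and3P[Uz /eqP rz _].
  have [w Ww azw] := U_nbr Uz; exists w => _.
  have rw : r w = z by rewrite -(r_adj _ _ azw) // WU.
  have nrw : w != r w by apply: contraTneq azw => ->; rewrite rw irr_adj.
  have [_ _ _ pw] := pP Ww nrw; split=> //.
  by rewrite pw ?rw // sym_adj.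
pose new z := (c z, z, z).
pose La2 := La :|: [set new z | z in Bad].
have new_inj : injective new by move=> z z' [].
have Bad0 z : z \in Bad -> link_deg La z = 0.
  by rewrite !inE => /and3P[_ _ /eqP].
have disj : [disjoint La & [set new z | z in Bad]].
  rewrite disjoint_sym; apply/pred0P => l /=; apply/negP => /andP[/imsetP[z Bz ->] Ll].
  have := @is_end_link_deg _ _ _ z Ll; rewrite /is_end eqxx orbT => /(_ isT).
  by rewrite Bad0.
have degE v : v \in W ->
    link_deg La2 v = (link_deg La v + ((r v \in Bad) && (c (r v) == v)) + (v \in Bad))%N.
  move=> Wv; rewrite link_degU // -addnA; congr (_ + _)%N.
  rewrite /link_deg big_imset => [|z z' _ _ /new_inj //].
  rewrite big_split /=; congr (_ + _)%N.
    have [Br | nBr] := boolP (r v \in Bad); last first.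
      rewrite big1 // => z Bz; have [_ _ _ rc] := cP z Bz.
      by apply/eqP; rewrite eqb0; apply: contraNneq nBr => <-; rewrite rc.
    rewrite (bigD1 (r v)) //= big1 ?addn0 // => z /andP[Bz nz].
    have [_ _ _ rc] := cP z Bz.
    by apply/eqP; rewrite eqb0; apply: contraNneq nz => <-; rewrite rc.
  have [Bv | nBv] := boolP (v \in Bad).
    by rewrite (bigD1 v) //= eqxx big1 // => z /andP[_ /negPf->].
  by rewrite big1 // => z Bz; apply/eqP; rewrite eqb0; apply: contraNneq nBv => <-.
have kindW a x b : (a, x, b) \in La2 ->
    [/\ a \in W, a != r a, a \in U & link_kind s a x b].
  rewrite inE => /orP[/kind[] | /imsetP[z Bz [-> -> ->]]].
    by rewrite mem_s => /andP[].
  have [Wc nrc pc rc] := cP z Bz; split=> //; last by apply: UpLink.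
  by apply: rU => //; rewrite rc; move: Bz; rewrite inE => /andP[].
pose D := [set v in U | 1 < link_deg La2 v].
exists La2, D; split.
- move=> a x b /kindW[Wa nra Ua]; have [Wp ap _ _] := pP Wa nra.
  case=> [-> -> | -> sb Ub pb nab ntab | -> sb Ub pb aab].
  + by split=> //; left.
  + have [_ abp _ _] : [/\ p b \in W, adj b (p b), h (p b) < h b & adj b (r b) -> p b = r b].
      by apply: pP; move: sb; rewrite mem_s => /andP[].
    by split=> //; [apply: WU | right; split=> //; rewrite sym_adj -pb].
  + by split; rewrite ?WU //; left.
(* A used edge is either a tree edge from [y] to [p y], with [y] an end and [p y] the middle of the
   link, or an edge between siblings; heights keep the two cases apart. *)
- have usesP e l : l \in La2 -> link_uses l e ->
      (exists y, [/\ is_end l y, y \in s, l.1.2 = p y & e = [set y; p y]]) \/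
      [/\ l \in La, l.1.1 \in s, l.2 \in s, p l.2 = p l.1.1 & e = [set l.1.1; l.2]].
    case: l => [[a x] b] Ll; have [Wa nra Ua ka] := kindW _ _ _ Ll.
    have sa : a \in s by rewrite mem_s Wa.
    rewrite /link_uses /= => ue; case: ka ue.
    + move=> -> -> /=; rewrite eqxx orbF => /eqP->; left; exists a.
      by rewrite /is_end eqxx.
    + move=> -> sb Ub pb nab ntab /orP[/eqP->|/andP[_ /eqP->]]; left.
        by exists a; rewrite /is_end eqxx.
      by exists b; rewrite /is_end eqxx orbT setUC pb.
    + move=> xb sb Ub pb aab; subst x; rewrite eqxx orbF => /eqP->; right; split=> //.
      move: Ll; rewrite inE => /orP[//|/imsetP[z Bz El]].
      have bz : b = z by case: El.
      move: sb; rewrite bz mem_s => /andP[_ /negP[]].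
      by move: Bz; rewrite !inE => /and3P[].
  have edge_inj y y' : y \in s -> y' \in s -> [set y; p y] = [set y'; p y'] -> y = y'.
    rewrite !mem_s => /andP[Wy ry] /andP[Wy' ry'] eqe.
    have [_ _ hy _] := pP Wy ry; have [_ _ hy' _] := pP Wy' ry'.
    have: y \in [set y'; p y'] by rewrite -eqe set21.
    have: y' \in [set y; p y] by rewrite eqe set21.
    rewrite !inE => /orP[/eqP-> // | /eqP e1] /orP[/eqP-> // | /eqP e2].
    by move: hy hy'; rewrite -e1 -e2 => lt1 /(ltn_trans lt1); rewrite ltnn.
  have sib_up a b y : a \in s -> b \in s -> y \in s -> p b = p a ->
      [set a; b] = [set y; p y] -> False.
    rewrite !mem_s => /andP[Wa ra] /andP[Wb rb] /andP[Wy ry] pba eqe.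
    have [_ _ ha _] := pP Wa ra; have [_ _ hb _] := pP Wb rb.
    have [_ _ hy _] := pP Wy ry.
    have: p y \in [set a; b] by rewrite eqe set22.
    have: y \in [set a; b] by rewrite eqe set21.
    rewrite !inE => /orP[] /eqP ya /orP[] /eqP pya; subst y.
    - by move: ha; rewrite pya ltnn.
    - by move: hb; rewrite pba pya ltnn.
    - by move: ha; rewrite -pba pya ltnn.
    - by move: hb; rewrite pya ltnn.
  have leW y : y \in s -> link_deg La y <= 1.
    by rewrite mem_s => /andP[_ /negPf ry]; have := dle y; rewrite ry.
  have newE l : l \in La2 -> l \in La \/ exists2 z, z \in Bad & l = new z.
    by rewrite inE => /orP[|/imsetP[z Bz ->]]; [left | right; exists z].
  (* An old link through the bad root [z] would force [z] to be covered already, by the last clause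
     of [good_links]. *)
  have old_new l z y : l \in La -> z \in Bad -> is_end (new z) y -> y \in s ->
      l.1.2 = p y -> False.
    move=> Ll Bz /orP[/eqP <- | /eqP <-] /=; last first.
      by rewrite mem_s => /andP[_ /negP[]]; move: Bz; rewrite !inE => /and3P[].
    have [_ _ -> _] := cP z Bz => _ lz; move: (Bz); rewrite !inE => /and3P[Uz rz /eqP d0].
    case: l Ll lz => [[a x] b] Ll /= xz; rewrite xz in Ll.
    by have := droot _ _ _ Ll rz Uz; rewrite d0.
  move=> e l l' Ll Ll' /(usesP _ _ Ll) ul /(usesP _ _ Ll') ul'.
  case: ul ul' => [[y [ely sy ly ->]] | [Lal sa sb pba ->]] []; last first.
  + case=> Lal' _ _ _ eqe; have: l.1.1 \in [set l'.1.1; l'.2] by rewrite -eqe set21.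
    rewrite !inE => el'; apply: (link_deg_le1_inj (leW _ sa)) => //.
      by rewrite /is_end eqxx.
    by rewrite /is_end ![_ == l.1.1]eq_sym.
  + by case=> y [_ sy _ eqe]; case: (sib_up _ _ _ sa sb sy pba eqe).
  + by case=> _ sa sb pba eqe; case: (sib_up _ _ _ sa sb sy pba (esym eqe)).
  case=> y' [ely' sy' ly' /edge_inj-/(_ sy sy') yy']; rewrite -{y'}yy' in ely' sy' ly'.
  case: (newE _ Ll) (newE _ Ll') => [Lal | [z Bz lz]] [Lal' | [z' Bz' lz']].
  + exact: (link_deg_le1_inj (leW _ sy)).
  + by case: (old_new l z' y) => //; rewrite -lz'.
  + by case: (old_new l' z y) => //; rewrite -lz.
  + by move: ly ly'; rewrite lz lz' /= => -> ->.
- move=> v; have [Wv | nWv] := boolP (v \in W); last first.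
    have [/link_deg_gt0[[[a x] b] Ll] | ] := ltnP 0 (link_deg La2 v); last first.
      by rewrite leqn0 => /eqP->.
    have [Wa nra Ua ka] := kindW _ _ _ Ll.
    rewrite /is_end /= => /orP[] /eqP ev; first by rewrite -ev Wa in nWv.
    case/negP: nWv; rewrite -ev; case: ka => [_ -> | _ _ Ub _ _ _ | _ _ Ub _ _].
    + by have [] := pP Wa nra.
    + exact: WU.
    + exact: WU.
  have [Uv | nUv] := boolP (v \in U).
    rewrite inE Uv /=; case: (ltnP 1 _) => // _; rewrite degE //.
    have := dle v; rewrite Uv andbT.
    have [rv | nrv] := eqVneq v (r v) => /=.
      have -> : (r v \in Bad) && (c (r v) == v) = false.
        apply/negP => /andP[/cP[_ nrc _ rc] /eqP cv].
        by case/eqP: nrc; rewrite rc cv.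
      have [/Bad0-> // | _] := boolP (v \in Bad); by rewrite !addn0.
    have -> : (v \in Bad) = false by rewrite !inE (negPf nrv) !andbF.
    by rewrite !addn0 => d1; apply: (@leq_add _ _ 1 1) => //; case: (_ && _).
  rewrite inE (negPf nUv) /= degE // addn0; have := dle v; rewrite (negPf nUv) andbF addn0.
  have -> : (v \in Bad) = false by rewrite !inE (negPf nUv).
  have -> : (r v \in Bad) = false.
    by apply: contraNF nUv; rewrite inE => /andP[Ur _]; apply: rU.
  by rewrite !addn0.
- move=> u Uu; rewrite degE ?WU //; have [Bu | nBu] := boolP (u \in Bad).
    by rewrite addn1.
  rewrite -addnA ltn_addr //; have [ru | nru] := eqVneq u (r u); last first.
    by apply: dgt0 => //; rewrite mem_s WU.
  by move: nBu; rewrite !inE Uu -ru eqxx /= -lt0n.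
split; first by apply/subsetP => v; rewrite inE => /andP[].
(* Each component has one candidate for [D]: the child [c (r d)] if the root is bad, the root
   otherwise. *)
have DP d : d \in D -> d = if r d \in Bad then c (r d) else r d.
  rewrite inE => /andP[Ud]; rewrite degE ?WU // => dd.
  have dled := dle d; case: ifP => [Br | nBr].
    move: dd; have [/eqP-> //|ncd] := boolP (c (r d) == d); rewrite andbF addn0.
    have [/[dup] Bd /Bad0-> // | _] := boolP (d \in Bad); rewrite addn0 => dd.
    move: dled; have [rd | nrd] := eqVneq d (r d); last by rewrite leqNgt dd.
    by rewrite -rd in Br; rewrite (Bad0 _ Br) in dd.
  have [// | nrd] := eqVneq d (r d); move: dled dd; rewrite (negPf nrd) nBr /= !addn0.
  have -> : (d \in Bad) = false by rewrite !inE (negPf nrd) !andbF.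
  by rewrite addn0 => le1; rewrite ltnNge le1.
move=> x y Dx Dy; apply/negP => axy.
have subD z : z \in D -> z \in W by rewrite inE => /andP[/WU].
have rxy : r x = r y by apply: r_adj => //; apply: subD.
by move: axy; rewrite (DP x) // (DP y) // rxy irr_adj.
Qed.
End Links.

Lemma links_exist (T : finType) (adj : rel T) (W U : {set T}) (t : T -> T) :
  symmetric adj -> irreflexive adj -> U \subset W ->
  (forall u, u \in U -> exists2 w, w \in W & adj u w) ->
  (forall u v, u \in U -> v \in U -> u != v -> t u = t v -> adj u v) ->
  exists (La : {set T * T * T}) (D : {set T}),
  [/\ forall a x b, (a, x, b) \in La ->
        [/\ a \in W, x \in W, b \in W, adj a x
          & x = b \/ [/\ adj x b, a != b & t a != t b]],
      forall e l l', l \in La -> l' \in La -> link_uses l e -> link_uses l' e -> l = l',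
      forall v, link_deg La v <= 1 + (v \in D),
      forall u, u \in U -> 0 < link_deg La u
    & D \subset U /\ forall x y, x \in D -> y \in D -> ~~ adj x y].
Proof.
move=> sym irr subUW U_nbr U_adj.
have [r [p [h [r_adj rU pP]]]] := rooted_forest W U sym.
exact: (links_of_forest sym irr subUW U_nbr U_adj r_adj rU pP).
Qed.

(** * The independent set S *)

Definition adjacent (T : finType) (E : {set {set T}}) : rel T :=
  fun u v => [set u; v] \in E.

Section Graph.
Variables (T : finType) (E : {set {set T}}).
Hypothesis simpleE : simple_graph E.
Hypothesis niceE : nice E.

Local Notation adj := (adjacent E).

Lemma adj_sym : symmetric adj.
Proof. by move=> u v; rewrite /adjacent setUC. Qed.

Lemma adj_irr : irreflexive adj.
Proof. by move=> u; apply/negP => /simpleE; rewrite setUid cards1. Qed.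

Lemma adj_neq u v : adj u v -> u != v.
Proof. by apply: contraTneq => ->; rewrite adj_irr. Qed.

Lemma edge_at e u : e \in E -> u \in e -> exists2 v, e = [set u; v] & adj u v.
Proof.
move=> Ee eu; have /cards2P[x [y [nxy De]]] : #|e| == 2 by rewrite simpleE.
rewrite De in Ee *; move: eu; rewrite De !inE => /orP[] /eqP->; first by exists y.
by exists x; rewrite /adjacent setUC.
Qed.

Lemma degree_eq1 u s : adj u s -> (forall w, adj u w -> w = s) -> degree E u = 1.
Proof.
move=> aus uniq_s; rewrite /degree.
suff -> : incident E u = [set [set u; s]] by rewrite cards1.
apply/setP => e; rewrite !inE; apply/andP/eqP => [[Ee eu] | ->].
  by have [v -> /uniq_s->] := edge_at Ee eu.
by rewrite set21.
Qed.

(* The weight makes S prefer pendant vertices to their neighbours. *)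
Lemma independent_set_choice : exists S : {set T},
  [/\ forall u v, u \in S -> v \in S -> ~~ adj u v,
      forall u, u \notin S -> exists2 s, s \in S & adj u s,
      forall u s, u \notin S -> s \in S -> adj u s ->
        (forall s', s' \in S -> adj u s' -> s' = s) ->
        exists2 w, w \notin S & adj u w
    & forall u v s, u \notin S -> v \notin S -> u != v -> s \in S ->
        (forall s', s' \in S -> adj u s' -> s' = s) ->
        (forall s', s' \in S -> adj v s' -> s' = s) -> adj u v].
Proof.
pose indep (X : {set T}) := [forall u in X, forall v in X, ~~ adj u v].
have indepP (X : {set T}) : reflect (forall u v, u \in X -> v \in X -> ~~ adj u v) (indep X).
  apply: (iffP forall_inP) => [h u v Xu | h u Xu]; first exact: (forall_inP (h u Xu)).
  by apply/forall_inP => v; apply: h.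
pose wt x := (2 + (degree E x == 1))%N.
pose weight (X : {set T}) := (\sum_(x in X) wt x)%N.
have indep0 : indep set0 by apply/indepP => u v; rewrite inE.
case: (arg_maxnP weight indep0) => S /indepP indS maxS.
have weightU1 x (X : {set T}) : x \notin X -> weight (x |: X) = (wt x + weight X)%N.
  by move=> nXx; rewrite /weight big_setU1.
have weightD1 x (X : {set T}) : x \in X -> weight X = (wt x + weight (X :\ x))%N.
  by move=> Xx; rewrite /weight (big_setD1 x).
have indU1 u (X : {set T}) : (forall x y, x \in X -> y \in X -> ~~ adj x y) ->
    (forall x, x \in X -> ~~ adj u x) -> forall x y, x \in u |: X -> y \in u |: X -> ~~ adj x y.
  move=> indX nux x y; rewrite !inE => /orP[/eqP->|Xx] /orP[/eqP->|Xy].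
  - by rewrite adj_irr.
  - exact: nux.
  - by rewrite adj_sym nux.
  - exact: indX.
have indD1 s x y : x \in S :\ s -> y \in S :\ s -> ~~ adj x y.
  by rewrite !inE => /andP[_ Sx] /andP[_ Sy]; apply: indS.
exists S; split=> //.
- move=> u nSu; apply/exists_inP; apply: contraT => /exists_inPn nus.
  have /maxS /= : indep (u |: S) by apply/indepP; apply: indU1.
  by rewrite weightU1 // /wt leqNgt -[X in (X < _)%N]add0n ltn_add2r.
(* Otherwise [u] is pendant with neighbour [s], and [s] is not pendant since the edge is not
   isolated: replacing [s] by [u] trades weight 2 for weight 3. *)
- move=> u s nSu Ss aus uniq_s; apply/exists_inP; apply: contraT => /exists_inPn nuw.
  have Nu w : adj u w -> w = s.
    move=> auw; have [Sw | nSw] := boolP (w \in S); first exact: uniq_s.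
    by case/negP: (nuw w nSw).
  have du : degree E u = 1 by apply: degree_eq1 Nu.
  have ds : degree E s != 1.
    apply/eqP => ds; case: (niceE (e := [set u; s])); split=> // i.
    by rewrite !inE => /orP[] /eqP->.
  have nu' : u \notin S :\ s by rewrite inE (negPf nSu) andbF.
  have /maxS /= : indep (u |: (S :\ s)).
    apply/indepP; apply: indU1; first exact: indD1.
    by move=> x; rewrite !inE => /andP[nxs Sx]; apply: contraNN nxs => /Nu->.
  rewrite weightU1 // (weightD1 s S) // /wt du eqxx (negPf ds) leqNgt.
  by rewrite ltn_add2r.
(* Otherwise replacing [s], of weight at most 3, by [u] and [v], of total weight at least 4, keeps
   the set independent. *)
- move=> u v s nSu nSv nuv Ss Nu Nv; apply: contraT => nauv.
  have nv' : v \notin S :\ s by rewrite inE (negPf nSv) andbF.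
  have nu' : u \notin v |: (S :\ s) by rewrite !inE (negPf nuv) (negPf nSu) andbF.
  have /maxS /= : indep (u |: (v |: (S :\ s))).
    apply/indepP; apply: (indU1); first (apply: (indU1); first exact: indD1).
      by move=> x; rewrite !inE => /andP[nxs Sx]; apply: contraNN nxs => /(Nv _ Sx)->.
    move=> x; rewrite !inE => /orP[/eqP-> // | /andP[nxs Sx]].
    by apply: contraNN nxs => /(Nu _ Sx)->.
  rewrite !weightU1 // (weightD1 s S) // leqNgt addnA ltn_add2r /wt.
  by do 3!case: (_ == 1).
Qed.

End Graph.

(** * Rows and columns *)

Section Assembly.
Variables (T : finType) (E : {set {set T}}).
Hypothesis simpleE : simple_graph E.
Local Notation adj := (adjacent E).

Variables (S U D : {set T}) (t : T -> T) (La : {set T * T * T}).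
Hypothesis indS : forall u v, u \in S -> v \in S -> ~~ adj u v.
(** [t u] is the last neighbour of [u] in S: on S the order [rho] below is that of [enum_rank]. *)
Hypothesis tP : forall u, u \notin S -> [/\ t u \in S, adj u (t u)
  & forall s, s \in S -> adj u s -> enum_rank s <= enum_rank (t u)].
Hypothesis UP : forall u,
  (u \in U) = (u \notin S) && [forall s in S, adj u s ==> (s == t u)].
Hypothesis LaP : forall a x b, (a, x, b) \in La ->
  [/\ a \in ~: S, x \in ~: S, b \in ~: S, adj a x
    & x = b \/ [/\ adj x b, a != b & t a != t b]].
Hypothesis La_uses : forall e l l',
  l \in La -> l' \in La -> link_uses l e -> link_uses l' e -> l = l'.
Hypothesis La_deg : forall v, link_deg La v <= 1 + (v \in D).
Hypothesis La_U : forall u, u \in U -> 0 < link_deg La u.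
Hypothesis subDU : D \subset U.
Hypothesis indD : forall x y, x \in D -> y \in D -> ~~ adj x y.

Let adjC : symmetric adj := @adj_sym T E.

(* Orders W \ D before D before S; no vertex of D has a later neighbour in W. *)
Definition rho (x : T) : nat :=
  (if x \in S then 2 else (x \in D : nat)) * #|T| + enum_rank x.

Lemma rho_inj : injective rho.
Proof.
move=> x y /(congr1 (modn^~ #|T|)); rewrite /rho !modnMDl !modn_small //.
by move/val_inj/enum_rank_inj.
Qed.

Lemma rho_lt_S x y : x \notin S -> y \in S -> rho x < rho y.
Proof.
move=> nSx Sy; rewrite /rho (negPf nSx) Sy.
apply: (@leq_trans (2 * #|T|)); last exact: leq_addr.
rewrite -addnS mul2n -addnn leq_add //.
by case: (x \in D); rewrite ?mul1n.
Qed.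

Lemma S_of_rho x y : x \in S -> rho x < rho y -> y \in S.
Proof.
by move=> Sx; apply: contraTT => nSy; rewrite -leqNgt ltnW // rho_lt_S.
Qed.

Lemma rho_le_S x y : x \in S -> y \in S -> (rho x <= rho y) = (enum_rank x <= enum_rank y).
Proof. by move=> Sx Sy; rewrite /rho Sx Sy leq_add2l. Qed.

Lemma D_notin_S x : x \in D -> x \notin S.
Proof. by move/(subsetP subDU); rewrite UP => /andP[]. Qed.

Lemma D_of_rho x y : x \in D -> y \notin S -> rho x < rho y -> y \in D.
Proof.
move=> Dx nSy; rewrite /rho Dx (negPf nSy) (negPf (D_notin_S Dx)).
case: (y \in D) => //; rewrite mul0n add0n mul1n ltnNge.
by rewrite (leq_trans (ltnW (ltn_ord _))) ?leq_addr.
Qed.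

(** * Consecutive later neighbours and the indices of the columns *)

Definition later u v := [pred w | adj u w && (rho v < rho w)].

(** The value [v] is a dummy, taken when no neighbour of [u] comes after [v]. *)
Definition nx u v : T :=
  if [pick w in later u v] is Some w0 then [arg min_(w < w0 in later u v) rho w] else v.

Definition hasnx u v := [exists w, w \in later u v].

Lemma nxP u v : hasnx u v -> [/\ adj u (nx u v), rho v < rho (nx u v)
  & forall w, adj u w -> rho v < rho w -> rho (nx u v) <= rho w].
Proof.
case/existsP=> w1 lw1; rewrite /nx; case: pickP => [w0 lw0 | /(_ w1)]; last by rewrite lw1.
case: arg_minnP => // w /andP[auw ltw] minw; split=> // w' auw' ltw'.
by apply: minw; rewrite inE auw'.
Qed.

Lemma nx_inj u v v' : adj u v -> adj u v' -> hasnx u v -> hasnx u v' ->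
  nx u v = nx u v' -> v = v'.
Proof.
move=> auv auv' /nxP[_ lt1 min1] /nxP[_ lt2 min2] eqn.
case: (ltngtP (rho v) (rho v')) => [lt | lt | /rho_inj //].
  by have := min1 _ auv' lt; rewrite eqn leqNgt lt2.
by have := min2 _ auv lt; rewrite -eqn leqNgt lt1.
Qed.

Lemma hasnx_W u v : u \notin S -> v \notin S -> hasnx u v.
Proof.
move=> nSu nSv; have [St aut _] := tP nSu.
by apply/existsP; exists (t u); rewrite inE aut rho_lt_S.
Qed.

(* colA indexes the edges inside W, colC the consecutive pairs of neighbours in S
   of a vertex of W, and colL the walks; the last two give two columns each. *)
Definition isA (p : T * T) :=
  [&& adj p.1 p.2, p.1 \notin S, p.2 \notin S & rho p.1 < rho p.2].
Definition isC (p : T * T) :=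
  [&& adj p.1 p.2, p.1 \notin S, p.2 \in S & hasnx p.1 p.2].
Definition colA : finType := {p | isA p}.
Definition colC : finType := {p | isC p}.
Definition colL : finType := {l | l \in La}.
Definition links : finType := (colC + colL)%type.
Definition cols : finType := (colA + links * bool)%type.

Definition label (k : links) (b : bool) : T :=
  match k with
  | inl p => if b then nx (val p).1 (val p).2 else (val p).2
  | inr l => if b then t (val l).2 else t (val l).1.1
  end.

(** The edge between [base k b] and [label k b] is the one behind row [(k, b)] of the S-block. *)
Definition base (k : links) (b : bool) : T :=
  match k with
  | inl p => (val p).1
  | inr l => if b then (val l).2 else (val l).1.1
  end.

Lemma lab_S k b : label k b \in S.
Proof.
case: k => [[[u s] /= isC_us] | [[[a x] c] /= Ll]].
  have /and4P[_ nSu Ss hn] := isC_us; case: b => //.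
  by have [_ lt _] := nxP hn; apply: S_of_rho lt.
have [] := LaP Ll; rewrite !inE => nSa _ nSc _ _.
by case: b; [have [] := tP nSc | have [] := tP nSa].
Qed.

Lemma base_W k b : base k b \notin S.
Proof.
case: k => [[[u s] /= /and4P[]] // | [[[a x] c] /= Ll]].
by have [] := LaP Ll; rewrite !inE; case: b.
Qed.

(** A neighbour [s] of [u] in S other than the last starts a consecutive pair. The last one, [t u],
    ends such a pair if [u] has another neighbour in S; otherwise [u] is in U and is an end of a
    walk. *)
Lemma WS_edge_covered u s : adj u s -> u \notin S -> s \in S ->
  exists k b, label k b = s /\ base k b = u.
Proof.
move=> aus nSu Ss; have [hn | nhn] := boolP (hasnx u s).
  have Cus : isC (u, s) by rewrite /isC /= aus nSu Ss.
  by exists (inl (exist _ (u, s) Cus)), false.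
have [St aut maxt] := tP nSu.
have ts : t u = s.
  apply/eqP; apply: contraNT nhn => nts; apply/existsP; exists (t u).
  rewrite inE aut ltn_neqAle rho_le_S // maxt // andbT.
  by apply: contraNneq nts => /rho_inj->.
have [Uu | nUu] := boolP (u \in U).
  have [[[a x] b] Ll /orP[]] := link_deg_gt0 (La_U Uu) => /= /eqP eu.
    by exists (inr (exist _ (a, x, b) Ll)), false; rewrite /= eu.
  by exists (inr (exist _ (a, x, b) Ll)), true; rewrite /= eu.
have [s0 /and3P[Ss0 aus0 ns0]] : exists s0, [&& s0 \in S, adj u s0 & s0 != t u].
  move: nUu; rewrite UP nSu /= => /forall_inPn[s0 Ss0]; rewrite negb_imply => h.
  by exists s0; rewrite Ss0.
have lt0 : rho s0 < rho (t u).
  rewrite ltn_neqAle rho_le_S // maxt // andbT.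
  by apply: contraNneq ns0 => /rho_inj->.
pose P s1 := [&& s1 \in S, adj u s1 & rho s1 < rho (t u)].
have P0 : P s0 by rewrite /P Ss0 aus0.
case: (arg_maxnP rho P0) => s1 /and3P[Ss1 aus1 lt1] max1.
have hn : hasnx u s1 by apply/existsP; exists (t u); rewrite inE aut.
have Cus : isC (u, s1) by rewrite /isC /= aus1 nSu Ss1.
exists (inl (exist _ (u, s1) Cus)), true; split=> //=; rewrite -ts.
have [aun ltn minn] := nxP hn; apply/eqP; apply: contraT => nn.
have Pn : P (nx u s1).
  rewrite /P aun (S_of_rho Ss1 ltn) ltn_neqAle minn // andbT.
  by apply: contraNneq nn => /rho_inj->.
by have := max1 _ Pn; rewrite /= leqNgt ltn.
Qed.

(** * Each edge is used by at most four columns *)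

Definition useP (u v : T) (e : {set T}) := (e == [set u; v]) || (e == [set u; nx u v]).

Definition useL (l : T * T * T) (e : {set T}) :=
  [|| e == [set l.1.1; t l.1.1], e == [set l.2; t l.2] | link_uses l e].

Definition uses (i : cols) (e : {set T}) : bool :=
  match i with
  | inl p => useP (val p).1 (val p).2 e
  | inr (inl p, _) => useP (val p).1 (val p).2 e
  | inr (inr l, _) => useL (val l) e
  end.

Lemma card_uses e : #|[set i | uses i e]| =
  #|[set p : colA | useP (val p).1 (val p).2 e]|
  + 2 * (#|[set p : colC | useP (val p).1 (val p).2 e]|
         + #|[set l : colL | useL (val l) e]|).
Proof.
have cardE (I : finType) (P : pred I) : #|[set i | P i]| = \sum_i P i.
  rewrite -sum1_card big_mkcond; apply: eq_bigr => i _.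
  by rewrite inE; case: (P i).
rewrite !cardE big_sumType /=; congr (_ + _).
rewrite big_prod_bool big_sumType mulnDr !big_distrr /=.
by congr (_ + _); apply: eq_bigr => i _; rewrite addnn mul2n.
Qed.

Lemma pair_eq u v a b : rho u < rho v -> rho a < rho b ->
  [set u; v] = [set a; b] -> u = a /\ v = b.
Proof.
move=> ltuv ltab eqs.
have: u \in [set a; b] by rewrite -eqs set21.
have: v \in [set a; b] by rewrite -eqs set22.
have: a \in [set u; v] by rewrite eqs set21.
have: b \in [set u; v] by rewrite eqs set22.
rewrite !inE => /orP[] /eqP ? /orP[] /eqP ? /orP[] /eqP ? /orP[] /eqP ?; subst; split=> //;
  by move: ltuv ltab; rewrite ?ltnn // => lt1; rewrite ltnNge ltnW.
Qed.

Lemma edge_WW_or_WS e : e \in E -> exists u v,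
  [/\ e = [set u; v], adj u v, u \notin S & rho u < rho v].
Proof.
move=> Ee; have /cards2P[x [y [nxy De]]] : #|e| == 2 by rewrite simpleE.
have axy : adj x y by rewrite /adjacent -De.
wlog lt : x y nxy De axy / rho x < rho y.
  move=> th; case: (ltngtP (rho x) (rho y)) => [| | /rho_inj eqxy].
  - exact: th.
  - by apply: th; rewrite 1?eq_sym 1?adjC // setUC.
  - by rewrite eqxy eqxx in nxy.
exists x, y; split=> //; apply/negP => Sx.
by have := indS Sx (S_of_rho Sx lt); rewrite axy.
Qed.

Section EdgeUsage.
Variables u v : T.
Hypotheses (nSu : u \notin S) (ltuv : rho u < rho v).
Local Notation e := [set u; v].

Let chain_eq a b : adj a b -> hasnx a b -> rho a < rho b -> useP a b e ->
  a = u /\ (b = v \/ nx u b = v).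
Proof.
move=> aab /nxP[_ ltn _] ltab /orP[] /eqP /esym/pair_eq.
  by case=> // -> ->; split=> //; left.
by case=> //; [apply: ltn_trans ltn | move=> -> ->; split=> //; right].
Qed.

Let isA_nx p : isA p -> hasnx p.1 p.2.
Proof. by case/and4P=> _ *; apply: hasnx_W. Qed.

Let C_lt p : isC p -> rho p.1 < rho p.2.
Proof. by case/and4P=> _ *; apply: rho_lt_S. Qed.

(** These are the pair starting at [v] and the pair ending at [v], the latter unique by [nx_inj]. *)
Lemma card_useA_le2 : #|[set p : colA | useP (val p).1 (val p).2 e]| <= 2.
Proof.
have sub : [set p : colA | useP (val p).1 (val p).2 e] \subset
    [set p : colA | val p == (u, v)] :|:
    [set p : colA | ((val p).1 == u) && (nx u (val p).2 == v)].
  apply/subsetP => -[[a b] /= iA]; rewrite !inE /= => ue.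
  have /and4P[/= aab _ _ ltab] := iA.
  by have [-> [->|->]] := chain_eq aab (isA_nx iA) ltab ue; rewrite !eqxx ?orbT.
apply: leq_trans (subset_leq_card sub) _; apply: leq_trans (leq_card_setU _ _) _.
rewrite (@leq_add _ _ 1 1) //; apply/card_le1_eqP => -[[a b] iA] [[a' b'] iA'].
  by rewrite !inE /= => /eqP eq1 /eqP eq2; apply: val_inj => /=; rewrite eq1 eq2.
rewrite !inE /= => /andP[/eqP ea /eqP eb] /andP[/eqP ea' /eqP eb'].
apply: val_inj => /=; congr (_, _); first by rewrite ea ea'.
subst a a'; have /and4P[/= a1 _ _ _] := iA; have /and4P[/= a2 _ _ _] := iA'.
by apply: (nx_inj a2 a1 (isA_nx iA') (isA_nx iA)); rewrite eb eb'.
Qed.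

(** Up to two columns come from [colA], none from [colC], whose edges all meet S, and at most one
    walk uses the edge, counted twice. *)
Lemma usage_WW : v \notin S -> #|[set i | uses i e]| <= 4.
Proof.
move=> nSv; rewrite card_uses (@leq_add _ _ 2 2) ?card_useA_le2 //.
have SW s x : s \in S -> e != [set x; s].
  move=> Ss; apply/eqP => Dx; have : s \in e by rewrite Dx set22.
  by rewrite !inE => /orP[] /eqP es; move: nSu nSv; rewrite -es Ss.
have -> : #|[set p : colC | useP (val p).1 (val p).2 e]| = 0.
  apply: eq_card0 => -[[a b] /= iC]; rewrite !inE /=; apply/negP.
  have /and4P[_ _ Sb hn] := iC; have [_ lt _] := nxP hn.
  by case/orP; apply/negP/SW => //; apply: S_of_rho lt.
rewrite (@leq_mul 2 _ 2 1) // add0n; apply/card_le1_eqP => -[l Ll] [l' Ll'].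
rewrite !inE /= => ul ul'; apply: val_inj => /=.
have useE k : k \in La -> useL k e -> link_uses k e.
  case: k => [[a x] b] Lk; have [] := LaP Lk; rewrite !inE => nSa _ nSb _ _.
  have [Sta _ _] := tP nSa; have [Stb _ _] := tP nSb.
  by rewrite /useL /= (negPf (SW _ _ Sta)) (negPf (SW _ _ Stb)).
by apply: (La_uses (e := e)) => //; apply: useE.
Qed.

(** The count is [nA + 2 * (nC + nL)]. A pair from [colA] uses the edge only if [v] is the first
    neighbour of [u] in S and [u] is not in [D]; a walk uses it only if [v = t u] and [u] is an end
    of the walk. *)
Lemma usage_WS : v \in S -> #|[set i | uses i e]| <= 4.
Proof.
move=> Sv; rewrite card_uses.
set nA := #|_|; set nC := #|_|; set nL := #|_|.
have [St aut maxt] := tP nSu.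
have A1 : nA <= 1.
  apply/card_le1_eqP => -[[a b] iA] [[a' b'] iA']; rewrite !inE /= => ue ue'.
  have /and4P[/= a1 _ nSb l1] := iA; have /and4P[/= a2 _ nSb' l2] := iA'.
  have [ea eb] := chain_eq a1 (isA_nx iA) l1 ue.
  have [ea' eb'] := chain_eq a2 (isA_nx iA') l2 ue'.
  case: eb => [eb | eb]; first by rewrite /= eb Sv in nSb.
  case: eb' => [eb' | eb']; first by rewrite /= eb' Sv in nSb'.
  apply: val_inj => /=; congr (_, _); first by rewrite ea ea'.
  subst a a'; apply: (nx_inj a2 a1 (isA_nx iA') (isA_nx iA)).
  by rewrite eb eb'.
have A_first : 0 < nA -> (u \notin D) /\ forall s, s \in S -> adj u s -> rho v <= rho s.
  case/card_gt0P=> -[[a b] iA]; rewrite !inE /= => ue.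
  have /and4P[/= a1 _ nSb l1] := iA.
  have [ea [eb | eb]] := chain_eq a1 (isA_nx iA) l1 ue.
    by rewrite /= eb Sv in nSb.
  subst a; have [_ lt min_v] := nxP (isA_nx iA); split.
    apply/negP => Du; have Db := D_of_rho Du nSb l1.
    by have := indD Du Db; rewrite a1.
  by move=> s Ss aus; rewrite -eb min_v // rho_lt_S.
pose next_v := (hasnx u v : nat).
pose prev_v := ([exists s, [&& s \in S, adj u s & rho s < rho v]] : nat).
have C_le : nC <= next_v + prev_v.
  have sub : [set p : colC | useP (val p).1 (val p).2 e] \subset
      [set p : colC | val p == (u, v)] :|:
      [set p : colC | ((val p).1 == u) && (nx u (val p).2 == v)].
    apply/subsetP => -[[a b] /= iC]; rewrite !inE /= => ue.
    have /and4P[/= aab _ _ hn] := iC.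
    by have [-> [->|->]] := chain_eq aab hn (C_lt iC) ue; rewrite !eqxx ?orbT.
  apply: leq_trans (subset_leq_card sub) _; apply: leq_trans (leq_card_setU _ _) _.
  apply: leq_add; rewrite /next_v /prev_v.
    have [hn | nhn] := boolP (hasnx u v).
      apply/card_le1_eqP => -[[a b] iC] [[a' b'] iC']; rewrite !inE /=.
      by move=> /eqP eq1 /eqP eq2; apply: val_inj => /=; rewrite eq1 eq2.
    rewrite leqn0 cards_eq0; apply/eqP/setP => -[[a b] iC]; rewrite !inE /=.
    by apply: contraNF nhn => /eqP[<- <-]; have /and4P[] := iC.
  case: (boolP [exists s, _]) => [_ | /existsPn np].
    apply/card_le1_eqP => -[[a b] iC] [[a' b'] iC']; rewrite !inE /=.
    move=> /andP[/eqP ea /eqP eb] /andP[/eqP ea' /eqP eb'].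
    apply: val_inj => /=; congr (_, _); first by rewrite ea ea'.
    subst a a'; have /and4P[/= a1 _ _ h1] := iC; have /and4P[/= a2 _ _ h2] := iC'.
    by apply: (nx_inj a2 a1 h2 h1); rewrite eb eb'.
  rewrite leqn0 cards_eq0; apply/eqP/setP => -[[a b] iC]; rewrite !inE /=.
  apply/negP => /andP[/eqP ea /eqP eb]; subst a.
  have /and4P[/= aub _ Sb hn] := iC; have [_ lt _] := nxP hn.
  by have := np b; rewrite Sb aub -eb lt.
have L_sub l : l \in La -> useL l e -> is_end l u /\ v = t u.
  case: l => [[a x] b] Ll; have [] := LaP Ll; rewrite !inE => nSa nSx nSb _ _.
  have [Sta _ _] := tP nSa; have [Stb _ _] := tP nSb.
  have noW y z : y \notin S -> z \notin S -> e = [set y; z] -> False.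
    move=> nSy nSz De; have: v \in [set y; z] by rewrite -De set22.
    by rewrite !inE => /orP[] /eqP vy; move: Sv nSy nSz; rewrite vy => ->.
  rewrite /useL /link_uses /is_end /=.
  case/or3P=> [/eqP/pair_eq[]//|/eqP/pair_eq[]//|]; rewrite ?rho_lt_S //.
  - by move=> <- ->; rewrite eqxx.
  - by move=> <- ->; rewrite eqxx orbT.
  - by case/orP => [/eqP/noW[] // | /andP[_ /eqP/noW[] //]].
have L_le : nL <= link_deg La u.
  rewrite /nL -(card_imset _ val_inj) /link_deg -sum1_card.
  rewrite big_mkcond [leqRHS]big_mkcond /=; apply: leq_sum => l _.
  case: imsetP => [[[k Lk]]|_]; last by [].
  rewrite inE /= => ul ->; rewrite Lk.
  by have [/orP[]/eqP-> _] := L_sub k Lk ul; rewrite eqxx // addn1.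
(* If [v] is not [t u], then [nL = 0], and [nC = 2] requires an earlier neighbour of [u] in S, which
   forces [nA = 0]. *)
have [vt | nvt] := eqVneq v (t u); last first.
  have -> : nL = 0.
    apply: eq_card0 => -[l Ll]; rewrite !inE /=; apply/negP => ul.
    by have [_ vt] := L_sub l Ll ul; rewrite vt eqxx in nvt.
  rewrite addn0; case: (posnP nA) => [-> | /A_first[_ first_v]].
    rewrite add0n (@leq_mul 2 _ 2 2) //; apply: leq_trans C_le _.
    by rewrite (@leq_add _ _ 1 1) // /next_v /prev_v; case: (X in nat_of_bool X).
  apply: (@leq_trans (1 + 2 * 1)) => //; rewrite leq_add // leq_mul //.
  apply: leq_trans C_le _; rewrite /prev_v.
  case: existsP => [[s /and3P[Ss aus lts]] | _]; last by rewrite addn0; apply: leq_b1.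
  by have := first_v s Ss aus; rewrite leqNgt lts.
have next0 : next_v = 0.
  apply/eqP; rewrite eqb0; apply/existsPn => s; rewrite inE; apply/negP => /andP[aus lts].
  have Ss := S_of_rho Sv lts.
  by move: lts; rewrite vt ltnNge rho_le_S // maxt.
rewrite next0 add0n in C_le.
have [Uu | nUu] := boolP (u \in U).
  have prev0 : prev_v = 0.
    apply/eqP; rewrite eqb0; apply/existsPn => s; apply/negP => /and3P[Ss aus lts].
    move: Uu; rewrite UP => /andP[_ /forall_inP/(_ s Ss)]; rewrite aus -vt => /eqP es.
    by rewrite es ltnn in lts.
  move: C_le; rewrite prev0 leqn0 => /eqP->; rewrite add0n.
  have dle := leq_trans L_le (La_deg u).
  have [Du | nDu] := boolP (u \in D).
    have -> : nA = 0 by case: (posnP nA) => // /A_first[]; rewrite Du.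
    by rewrite add0n (@leq_mul 2 _ 2 2) // (leq_trans dle) // Du.
  apply: (@leq_trans (1 + 2 * 1)) => //; rewrite leq_add // leq_mul //.
  by rewrite (negPf nDu) addn0 in dle.
(* Now [v] is the last but not the first neighbour of [u] in S: [nA = 0], while [nC] and [nL] are at
   most 1. *)
have [s0 /and3P[Ss0 aus0 ns0]] : exists s0, [&& s0 \in S, adj u s0 & s0 != t u].
  move: nUu; rewrite UP nSu /= => /forall_inPn[s0 Ss0]; rewrite negb_imply => h.
  by exists s0; rewrite Ss0.
have -> : nA = 0.
  case: (posnP nA) => // /A_first[_ /(_ s0 Ss0 aus0)].
  rewrite vt rho_le_S // => le1; have le2 := maxt s0 Ss0 aus0.
  by case/eqP: ns0; apply/enum_rank_inj/val_inj/eqP; rewrite eqn_leq le1 le2.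
rewrite add0n (@leq_mul 2 _ 2 2) // (@leq_add _ _ 1 1) //.
  by apply: leq_trans C_le _; apply: leq_b1.
apply: leq_trans L_le _; apply: leq_trans (La_deg u) _.
by rewrite (contraNF (subsetP subDU u)).
Qed.

End EdgeUsage.

Lemma usage_le4 e : e \in E -> #|[set i | uses i e]| <= 4.
Proof.
case/edge_WW_or_WS=> u [v [-> auv nSu ltuv]].
by have [Sv | nSv] := boolP (v \in S); [apply: usage_WS | apply: usage_WW].
Qed.

(** * Pairings of rows with columns, and their permanent *)

Section Columns.
Local Open Scope ring_scope.
Variable R : realFieldType.

Definition ed (u v : T) (e : {set T}) : R := (e == [set u; v])%:R.

Definition chain_col (u v : T) (e : {set T}) : R := ed u v e - ed u (nx u v) e.

(** The alternating sum of the edges of the walk; the inner vertices cancel, leaving x_(t a) + x_(t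
    b) for the walk of three edges and x_(t a) - x_(t b) for the one of four. *)
Definition link_col (l : T * T * T) (e : {set T}) : R :=
  ed l.1.1 (t l.1.1) e - ed l.1.1 l.1.2 e
  + (if l.1.2 == l.2 then ed l.2 (t l.2) e else ed l.1.2 l.2 e - ed l.2 (t l.2) e).

Definition col_form (i : cols) (e : {set T}) : R :=
  match i with
  | inl p => chain_col (val p).1 (val p).2 e
  | inr (inl p, _) => chain_col (val p).1 (val p).2 e
  | inr (inr l, _) => link_col (val l) e
  end.

Definition eps (k : links) : R :=
  match k with inl _ => -1 | inr l => if (val l).1.2 == (val l).2 then 1 else -1 end.

(** The form X_v evaluated at [c]. *)
Definition vsum (c : {set T} -> R) (v : T) : R := \sum_(e in incident E v) c e.

Lemma vsum_ed u w v : adj u w -> vsum (ed u w) v = (v == u)%:R + (v == w)%:R.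
Proof.
move=> auw; transitivity (([set u; w] \in incident E v)%:R : R).
  rewrite /vsum; have [If | nIf] := boolP ([set u; w] \in incident E v).
    by rewrite (bigD1 [set u; w]) //= /ed eqxx big1 ?addr0 // => e /andP[_ /negPf->].
  rewrite big1 // => e Ie; rewrite /ed; case: eqP => // De.
  by rewrite -De Ie in nIf.
rewrite inE [_ \in E]auw /= !inE; have [-> | _] := eqVneq v u; last by rewrite add0r.
by rewrite (negPf (adj_neq simpleE auw)) addr0.
Qed.

Lemma vsumB c d v : vsum (fun e => c e - d e) v = vsum c v - vsum d v.
Proof. by rewrite /vsum sumrB. Qed.

Lemma vsumD c d v : vsum (fun e => c e + d e) v = vsum c v + vsum d v.
Proof. by rewrite /vsum big_split. Qed.

Lemma vsum_chain u w v : adj u w -> hasnx u w ->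
  vsum (chain_col u w) v = (v == w)%:R - (v == nx u w)%:R.
Proof.
move=> auw /nxP[aun _ _]; rewrite /chain_col vsumB !vsum_ed //.
by ring.
Qed.

Lemma vsum_link k b v : vsum (col_form (inr (k, b))) v =
  (v == label k false)%:R + eps k * (v == label k true)%:R.
Proof.
case: k => [[[u s] isC_us] | [[[a x] c] Ll]] /=.
  by have /and4P[aus _ _ hn] := isC_us; rewrite vsum_chain // mulN1r.
have [] := LaP Ll; rewrite !inE => nSa _ nSc aax xc.
have [_ aat _] := tP nSa; have [_ act _] := tP nSc.
rewrite /link_col vsumD vsumB /=; have [exc | nxc] := eqVneq x c.
  by rewrite !vsum_ed // exc; ring.
have axc : adj x c by case: xc => [/eqP|[]//]; rewrite (negPf nxc).
by rewrite vsumB !vsum_ed //; ring.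
Qed.

Lemma ed_neq0 u v e : ed u v e != 0 -> e = [set u; v].
Proof. by rewrite pnatr_eq0 eqb0 negbK => /eqP. Qed.

Lemma addr_neq0 (x y : R) : x + y != 0 -> (x != 0) || (y != 0).
Proof. by apply: contraNT; rewrite negb_or !negbK => /andP[/eqP-> /eqP->]; rewrite addr0. Qed.

Lemma chain_col_neq0 u v e : chain_col u v e != 0 -> useP u v e.
Proof.
by case/addr_neq0/orP; rewrite ?oppr_eq0 => /ed_neq0->; rewrite /useP eqxx ?orbT.
Qed.

Lemma link_col_neq0 l e : link_col l e != 0 -> useL l e.
Proof.
rewrite /useL /link_uses; case/addr_neq0/orP => [/addr_neq0/orP[]|].
- by move=> /ed_neq0->; rewrite eqxx.
- by rewrite oppr_eq0 => /ed_neq0->; rewrite eqxx !orbT.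
case: ifP => [_ /ed_neq0-> | _ /addr_neq0/orP[/ed_neq0->|]].
- by rewrite eqxx orbT.
- by rewrite eqxx !orbT.
- by rewrite oppr_eq0 => /ed_neq0->; rewrite eqxx orbT.
Qed.

Lemma col_uses i e : col_form i e != 0 -> uses i e.
Proof.
case: i => [p | [[p|l] b]] /=; [exact: chain_col_neq0 | exact: chain_col_neq0 |].
exact: link_col_neq0.
Qed.

Lemma uses_E i e : uses i e -> e \in E.
Proof.
have useP_E u v : adj u v -> hasnx u v -> useP u v e -> e \in E.
  by move=> auv /nxP[aun _ _] /orP[] /eqP->.
case: i => [[p iA] | [[[p iC]|[[[a x] c] Ll]] b]] /=.
- by have /and4P[a1 nS1 nS2 _] := iA; apply: useP_E => //; apply: hasnx_W.
- by have /and4P[a1 _ _ hn] := iC; apply: useP_E.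
have [] := LaP Ll; rewrite !inE => nSa _ nSc aax xc.
have [_ aat _] := tP nSa; have [_ act _] := tP nSc.
case/or3P=> [/eqP-> // | /eqP-> // | /orP[/eqP-> // | /= /andP[nxc /eqP->]]].
by case: xc nxc => [->|[]//]; rewrite eqxx.
Qed.

(* Row i is X_(hi i) - X_(lo i). An edge between W and S may give several rows;
   the repetitions are the multiplier of P. *)
Definition hi (i : cols) : T :=
  match i with inl p => (val p).2 | inr kb => label kb.1 kb.2 end.
Definition lo (i : cols) : T :=
  match i with inl p => (val p).1 | inr kb => base kb.1 kb.2 end.

(** Link columns vanish on W, so the matrix is block triangular. In the S-block the [base] terms
    vanish and [link_permanent_neq0] applies. The block of [colA] is ranked by the later vertex of
    the pair: a column lives on that vertex and a still later one, so a row of smaller rank misses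
    it and one of equal rank gives 1. *)
Lemma permanent_cols_neq0 :
  permanent (fun i j : cols => vsum (col_form j) (hi i) - vsum (col_form j) (lo i)) != 0.
Proof.
have W0 v k b : v \notin S -> vsum (col_form (inr (k, b))) v = 0.
  move=> nSv; rewrite vsum_link.
  have ne b' : (v == label k b') = false by apply: contraNF nSv => /eqP->; apply: lab_S.
  by rewrite !ne mulr0 addr0.
rewrite permanent_block => [|[p iA] [k b]]; last first.
  by have /and4P[_ nS1 nS2 _] := iA; rewrite /= !W0 ?subrr.
rewrite mulf_neq0 //; last first.
  rewrite (_ : permanent _ = permanent (fun i j : links * bool =>
      (label i.1 i.2 == label j.1 false)%:R + eps j.1 * (label i.1 i.2 == label j.1 true)%:R)).
    apply: link_permanent_neq0 => [k | [[[u s] isC_us] | [[[a x] c] Ll]] /=].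
    - by case: k => [p|l] /=; [|case: ifP]; rewrite ?mulrNN mulr1.
    - by have /and4P[_ _ _ /nxP[_ /[swap] _ /[swap] <-]] := isC_us; rewrite ltnn.
    - have [_ _ _ _ xc] := LaP Ll; case: ifP => // nxc eqt.
      by case: xc => [xc|[_ _]]; [rewrite xc eqxx in nxc | rewrite eqt eqxx].
  apply: eq_bigr => s _; apply: eq_bigr => -[k b] _; case: (s (k, b)) => k' b' /=.
  by rewrite (W0 (base k b)) ?base_W // subr0 vsum_link.
pose r (p : colA) := rho (val p).2.
have nxA (p : colA) : hasnx (val p).1 (val p).2.
  by have /and4P[_ nS1 nS2 _] := valP p; apply: hasnx_W.
have vE (q : colA) v : vsum (col_form (inl q)) v = (v == (val q).2)%:R - (v == nx (val q).1 (val q).2)%:R.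
  by rewrite vsum_chain ?nxA //; have /and4P[] := valP q.
have ltA (p : colA) : (rho (val p).1 < rho (val p).2)%N by have /and4P[] := valP p.
have ltnxA (p : colA) : (rho (val p).2 < rho (nx (val p).1 (val p).2))%N.
  by have [] := nxP (nxA p).
apply: (permanent_ranked (r := r)) => p q; rewrite /= !vE /r.
  apply: contraNT; rewrite -ltnNge => lt.
  have h v : (rho v <= rho (val p).2)%N ->
      (v == (val q).2) = false /\ (v == nx (val q).1 (val q).2) = false.
    move=> lev; split; apply/eqP => ev; move: lev; rewrite ev leqNgt ?lt //.
    by rewrite (ltn_trans lt).
  have [-> ->] := h _ (leqnn _); have [-> ->] := h _ (ltnW (ltA p)).
  by rewrite !subr0.
move/rho_inj => eq2.
have ne v w : (rho v < rho w)%N -> (v == w) = false.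
  by move=> lt; apply: contraTF lt => /eqP->; rewrite ltnn.
rewrite -eq2 eqxx (ne _ _ (ltnxA q)) -[X in X == _]/((val p).1).
rewrite eq2 (ne _ _ (ltA p)) -eq2 (ne (val p).1 (nx _ _)) ?subr0 //.
by apply: ltn_trans (ltnxA q); rewrite eq2.
Qed.

Lemma set0_notin_E : set0 \notin E.
Proof. by apply/negP => /simpleE; rewrite cards0. Qed.

(* The index set0, which is not an edge, carries the constant term. *)
Definition row_form (phiV : T -> R) (i : cols) (e : {set T}) : R :=
  if e == set0 then phiV (hi i) - phiV (lo i)
  else (e \in incident E (hi i))%:R - (e \in incident E (lo i))%:R.

Lemma row_pairing phiV i c : \sum_e row_form phiV i e * c e =
  (phiV (hi i) - phiV (lo i)) * c set0 + (vsum c (hi i) - vsum c (lo i)).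
Proof.
have vsumE v : vsum c v = \sum_(e | e != set0) (e \in incident E v)%:R * c e.
  rewrite /vsum big_mkcond [RHS]big_mkcond; apply: eq_bigr => e _.
  have [-> | _] := eqVneq e set0.
    by rewrite inE (negPf set0_notin_E).
  by case: ifP; rewrite ?mul1r ?mul0r.
rewrite (bigD1 set0) //= /row_form eqxx; congr (_ + _); rewrite !vsumE -sumrB.
by apply: eq_bigr => e /negPf->; rewrite mulrBl.
Qed.

Lemma weighting_exists (phiV : T -> R) (LE : {set T} -> seq R) :
  (forall e, e \in E -> uniq (LE e) /\ size (LE e) = 5%N) ->
  exists phiE : {set T} -> R, (forall e, e \in E -> phiE e \in LE e) /\
    forall u v, adj u v -> vsum phiE u + phiV u != vsum phiE v + phiV v.
Proof.
(* Sets that are not edges get a dummy list of five numbers; the columns vanish on them. *)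
move=> LEP; pose L e := if e \in E then LE e else [seq i%:R | i <- iota 0 5].
have uL e : uniq (L e).
  rewrite /L; case: ifP => [/LEP[] // | _].
  by rewrite map_inj_uniq ?iota_uniq // => i j /eqP; rewrite eqr_nat => /eqP.
have sL e : size (L e) = 5%N by rewrite /L; case: ifP => [/LEP[] // | _]; rewrite size_map.
have col0 i e : e \notin E -> col_form i e = 0.
  by move=> nEe; apply/eqP; apply: contraNT nEe => /col_uses/uses_E.
have usage e : (#|[set i | (col_form i e != 0)%R]| <= 4)%N.
  have [Ee | nEe] := boolP (e \in E).
    apply: leq_trans (usage_le4 Ee); apply/subset_leq_card/subsetP => i.
    by rewrite !inE; apply: col_uses.
  by rewrite (eq_card0 (A := [set _ | _])) // => i; rewrite !inE col0 ?eqxx.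
have [|phi [phi0 phiL phi_neq]] := grid_nonzero_of_permanent (A := row_form phiV)
    uL sL (fun i => col0 i _ set0_notin_E) usage.
  (* The constant terms meet the zero coordinate [set0] of the columns, so the vertex weights drop
     out of the permanent. *)
  rewrite (_ : \sum_s _ = permanent (fun i j => vsum (col_form j) (hi i) - vsum (col_form j) (lo i))).
    exact: permanent_cols_neq0.
  apply: eq_bigr => s _; apply: eq_bigr => i _.
  by rewrite row_pairing col0 ?set0_notin_E // mulr0 add0r.
exists phi; split=> [e Ee | u v auv].
  have: phi e \in L e by apply: phiL; apply: contraTneq Ee => ->; apply: set0_notin_E.
  by rewrite /L Ee.
have rowN i : vsum phi (hi i) + phiV (hi i) != vsum phi (lo i) + phiV (lo i).
  have := phi_neq i; rewrite row_pairing phi0 mulr1; apply: contraNneq => eqs.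
  apply/eqP; rewrite -[RHS](subrr (vsum phi (lo i) + phiV (lo i))) -{1}eqs.
  by ring.
wlog [lt nSu] : u v auv / (rho u < rho v)%N /\ u \notin S.
  move=> th; have [x [y [Dxy axy nSx lt]]] := edge_WW_or_WS auv.
  have [[-> ->] | [-> ->]] : (u = x /\ v = y) \/ (u = y /\ v = x).
  - have [x_uv y_uv] : x \in [set u; v] /\ y \in [set u; v].
      by rewrite Dxy set21 set22.
    have nxy := adj_neq simpleE axy.
    move: x_uv y_uv nxy; rewrite !inE => /orP[] /eqP-> /orP[] /eqP->; rewrite ?eqxx //.
      by left.
    by right.
  - exact: th.
  - by rewrite eq_sym; apply: th.
have [Sv | nSv] := boolP (v \in S).
  have [k [b [<- <-]]] := WS_edge_covered auv nSu Sv.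
  by rewrite eq_sym; apply: (rowN (inr (k, b))).
have iA : isA (u, v) by rewrite /isA /= auv nSu nSv.
by rewrite eq_sym; apply: (rowN (inl (exist _ (u, v) iA))).
Qed.

End Columns.
End Assembly.

Theorem theorem1p1 (R : realType) (T : finType) (E : {set {set T}})
  (Hsimple : simple_graph E) (Hnice : nice E)
  (LV : T -> seq R) (LE : {set T} -> seq R)
  (HLV : forall v : T, uniq (LV v) /\ size (LV v) = 1%N)
  (HLE : forall e, e \in E -> uniq (LE e) /\ size (LE e) = 5%N) :
  exists (phiV : T -> R) (phiE : {set T} -> R),
    (forall v : T, phiV v \in LV v) /\
    (forall e, e \in E -> phiE e \in LE e) /\
    (forall u v : T, [set u; v] \in E ->
       ((\sum_(e in incident E u) phiE e) + phiV u !=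
        (\sum_(e in incident E v) phiE e) + phiV v)%R).
Proof.
have [S [indS domS W_nbr W_adj]] := independent_set_choice Hsimple Hnice.
have /fin_all_exists[t tP] u : exists s, u \notin S ->
    [/\ s \in S, adjacent E u s
      & forall s', s' \in S -> adjacent E u s' -> enum_rank s' <= enum_rank s].
  have [Su | /domS[s0 Ss0 aus0]] := boolP (u \in S); first by exists u.
  pose P s := (s \in S) && adjacent E u s.
  have P0 : P s0 by rewrite /P Ss0.
  case: (@arg_maxnP _ _ P (fun s => enum_rank s : nat) P0) => s /andP[Ss aus] max_s.
  by exists s => _; split=> // s' Ss' aus'; apply: max_s; rewrite /P Ss'.
pose U := [set u | (u \notin S) && [forall s in S, adjacent E u s ==> (s == t u)]].
have UP u : (u \in U) = (u \notin S) && [forall s in S, adjacent E u s ==> (s == t u)].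
  by rewrite inE.
have Uuniq u s : u \in U -> s \in S -> adjacent E u s -> s = t u.
  by rewrite UP => /andP[_ /forall_inP h] Ss aus; have := h s Ss; rewrite aus => /eqP.
have UW u : u \in U -> u \notin S by rewrite UP => /andP[].
have [|u Uu|u v Uu Uv nuv tuv|La [D [LaP La_uses La_deg La_U [subDU indD]]]] :=
    @links_exist T (adjacent E) (~: S) U t (@adj_sym T E) (adj_irr Hsimple).
- by apply/subsetP => u; rewrite in_setC; apply: UW.
- have [St aut _] := tP u (UW u Uu).
  have [w nSw auw] := W_nbr u (t u) (UW u Uu) St aut (fun s Ss => Uuniq u s Uu Ss).
  by exists w; rewrite ?in_setC.
- have [St _ _] := tP u (UW u Uu).
  apply: (W_adj u v (t u)) => //; rewrite ?UW // => s Ss.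
    exact: Uuniq.
  by rewrite tuv; apply: Uuniq.
(* The lists at vertices are singletons, so the default of [head] is never taken. *)
pose phiV v : R := head 0%R (LV v).
have [phiE [phiEL phiE_neq]] :=
  weighting_exists Hsimple indS tP UP LaP La_uses La_deg La_U subDU indD phiV HLE.
exists phiV, phiE; split=> [v|]; last by split.
by have [_] := HLV v; rewrite /phiV; case: (LV v) => // x s _; rewrite mem_head.
Qed.
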